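(* The product $I_{\nu}(x)K_{\nu}(x)$ can be bounded by $$F_{-1}^{(p,q)}(\nu,x)<I_{\nu}(x)K_{\nu}(x)<F_{+1}^{(p,q)}(\nu,x),\qquad x>0,$$ where the lower bounds hold for $\nu\ge \nu_L^{(p,q)}$ and the upper bounds hold for $\nu\ge \nu_U^{(p,q)}$, for the following sets of functions and ranges. 1. $F_{\lambda}^{(0,1)}(\nu,x)=\dfrac{1}{\sqrt{\nu^2+x^2}+\sqrt{(\nu-\lambda)^2+x^2}-\lambda}$, $\nu_L^{(0,1)}=-1$, $\nu_U^{(0,1)}=0$. 2. $F_{\lambda}^{(1,0)}(\nu,x)=\dfrac{1}{2\sqrt{\nu^2+\frac{\nu}{\nu+\lambda}x^2}}$, $\nu_L^{(1,0)}=1$, $\nu_U^{(1,0)}=0$. 3. $F_{\lambda}^{(0,2)}(\nu,x)=\dfrac{1}{2\sqrt{(\nu-\lambda/2)^2+x^2}}$, $\nu_L^{(0,2)}=-\frac12$, $\nu_U^{(0,2)}=\frac12$. 4. $F_{\lambda}^{(1,1)}(\nu,x)=\dfrac{1}{\sqrt{\nu^2+x^2}+\sqrt{(\nu+\lambda)^2+x^2}-\lambda}$, $\nu_L^{(1,1)}=0$, $\nu_U^{(1,1)}=-1$. 5. $F_{\lambda}^{(2,0)}(\nu,x)=\dfrac{1}{\sqrt{(\nu-2\lambda)^2+\frac{\nu-2\lambda}{\nu-\lambda}x^2}+\sqrt{\nu^2+\frac{\nu}{\nu+\lambda}x^2}+2\lambda}$, $\nu_L^{(2,0)}=1$, $\nu_U^{(2,0)}=2$.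 6. $F_{\lambda}^{(1,2)}(\nu,x)=\dfrac{1}{\nu+\frac{\lambda}{2}+\sqrt{(\nu-\frac{\lambda}{2})^2+x^2}+\dfrac{x^2}{\nu+\frac{\lambda}{2}+\sqrt{(\nu+\frac{3\lambda}{2})^2+x^2}}}$, $\nu_L^{(1,2)}=\frac32$, $\nu_U^{(1,2)}=\frac12$. 7. $F_{\lambda}^{(2,1)}(\nu,x)=\dfrac{1}{\nu-\lambda+\sqrt{(\nu+\lambda)^2+x^2}+\dfrac{x^2}{\nu-\lambda+\sqrt{(\nu-2\lambda)^2+x^2}}}$, $\nu_L^{(2,1)}=-1$, $\nu_U^{(2,1)}=0$. 8. $F_{\lambda}^{(3,0)}(\nu,x)=\dfrac{1}{\nu+2\lambda+\sqrt{(\nu-2\lambda)^2+\frac{\nu-2\lambda}{\nu-\lambda}x^2}+\dfrac{x^2}{\nu+\lambda+\sqrt{(\nu+3\lambda)^2+\frac{\nu+3\lambda}{\nu+2\lambda}x^2}}}$, $\nu_L^{(3,0)}=3$, $\nu_U^{(3,0)}=2$. 9. $F_{\lambda}^{(0,3)}(\nu,x)=\dfrac{1}{\nu-\frac{\lambda}{2}+\sqrt{\nu^2-\frac14+x^2}+\dfrac{x^2}{\nu-\frac32\lambda+\sqrt{(\nu-\lambda)^2-\frac14+x^2}}}$, $\nu_L^{(0,3)}=\frac12$, $\nu_U^{(0,3)}=\frac32$.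
   Context: $I_\nu(x)$ and $K_\nu(x)$ denote the modified Bessel functions of the first and second kind, of real order $\nu$ and real argument $x>0$. The subscript $\lambda$ takes the values $-1$ (lower bounds) and $+1$ (upper bounds), and $(p,q)$ is a label running over the nine pairs listed.
   Formalization: Items 7 and 9 are false as printed; the inner denominators are corrected to ν+√((ν−2λ)²+x²) in item 7 and ν−λ/2+√((ν−λ)²−1/4+x²) in item 9. Where a formula divides by zero at an endpoint (items 2 and 5), 1/0 is read as +∞ and 1/(+∞) as 0. *)

(* Defs.v *)
From HB Require Import structures.
From mathcomp Require Import all_boot all_order all_algebra.
From mathcomp Require Import all_classical all_reals all_analysis.

Set Implicit Arguments.
Unset Strict Implicit.
Unset Printing Implicit Defensive.

Import Order.TTheory GRing.Theory Num.Theory.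
Import numFieldNormedType.Exports.

Local Open Scope classical_set_scope.
Local Open Scope ring_scope.

(* Euler's integral; only meaningful for z > 0. *)
Definition Gamma {R : realType} (z : R) : R :=
  \int[lebesgue_measure]_(t in `]0, +oo[) (t `^ (z - 1) * expR (- t)).

(* The entire function 1 / Gamma on all of R: for z <= 0 the functional
   equation Gamma (z + n) = z (z + 1) ... (z + n - 1) Gamma z is used with an n
   such that z + n > 0, so that the value is 0 at the poles 0, -1, -2, ... *)
Definition rGamma {R : realType} (z : R) : R :=
  if 0 < z then (Gamma z)^-1
  else let n := (Num.truncn (- z)).+1 in
       (\prod_(i < n) (z + i%:R)) / Gamma (z + n%:R).

Definition besselI {R : realType} (nu x : R) : R :=
  limn (series (fun k : nat =>
    (x / 2) `^ (nu + k.*2%:R) * rGamma (nu + k%:R + 1) / k`!%:R)).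

(* K_nu(x) = int_0^oo exp (- x cosh t) cosh (nu t) dt, valid for x > 0 and every
   real order, integer orders included. *)
Definition cosh {R : realType} (t : R) : R := (expR t + expR (- t)) / 2.

Definition besselK {R : realType} (nu x : R) : R :=
  \int[lebesgue_measure]_(t in `[0, +oo[) (expR (- (x * cosh t)) * cosh (nu * t)).

(* The constructor Bpq stands for the label (p, q). *)
Variant bound_label := B01 | B10 | B02 | B11 | B20 | B12 | B21 | B30 | B03.

Definition nuL {R : realType} (pq : bound_label) : R :=
  match pq with
  | B01 => - 1
  | B10 => 1
  | B02 => - (1 / 2)
  | B11 => 0
  | B20 => 1
  | B12 => 3 / 2
  | B21 => - 1
  | B30 => 3
  | B03 => 1 / 2
  end.

Definition nuU {R : realType} (pq : bound_label) : R :=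
  match pq with
  | B01 => 0
  | B10 => 0
  | B02 => 1 / 2
  | B11 => - 1
  | B20 => 2
  | B12 => 1 / 2
  | B21 => 0
  | B30 => 2
  | B03 => 3 / 2
  end.

(* sqrt (a^2 + (a / b) x^2) in the extended reals, where a / 0 = +oo for
   a > 0. *)
Definition esqrt_ratio {R : realType} (a b x : R) : \bar R :=
  (sqrte ((a ^+ 2)%:E + a%:E / b%:E * (x ^+ 2)%:E))%E.

(* The denominator of F_lam^(p,q)(nu, x).  Extended reals are needed at closed
   endpoints of the ranges: B10 and B20 are +oo for lam = -1, nu = 1, and B10
   is 0 for lam = 1, nu = 0.

   The two inner offsets nu (in B21) and nu - lam / 2 (in B03) correct misprints
   of the source, which has nu - lam and nu - 3 lam / 2.  The misprinted bounds
   are false, e.g. for (0,3), lam = -1, nu = 1/2, x = 1, where the product is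
   (1 - exp(-2)) / 2 = 0.4323... and the "lower bound" is 0.4409..., and for
   (2,1), lam = 1, nu = 1/2, x = 10, where the product is
   (1 - exp(-20)) / 20 = 0.04999999... and the "upper bound" is 0.04996...
   The corrected terms come from
     1 / (I_nu K_nu) = x I_(nu-1) / I_nu + x^2 / (x K_nu / K_(nu-1))
                     = x K_(nu+1) / K_nu + x^2 / (x I_nu / I_(nu+1))
   and the bounds
     x I_(mu-1) / I_mu > mu - 1 + sqrt ((mu + 1)^2 + x^2),
     x K_(mu+1) / K_mu < mu + 1 + sqrt ((mu - 1)^2 + x^2)
   for (2,1), respectively
     x I_(mu-1) / I_mu > mu - 1/2 + sqrt (mu^2 - 1/4 + x^2),
     x K_(mu+1) / K_mu < mu + 1/2 + sqrt (mu^2 - 1/4 + x^2)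
   for (0,3). *)
Definition denF {R : realType} (pq : bound_label) (lam nu x : R) : \bar R :=
  match pq with
  | B01 => (Num.sqrt (nu ^+ 2 + x ^+ 2)
            + Num.sqrt ((nu - lam) ^+ 2 + x ^+ 2) - lam)%:E
  | B10 => (2%:E * esqrt_ratio nu (nu + lam) x)%E
  | B02 => (2 * Num.sqrt ((nu - lam / 2) ^+ 2 + x ^+ 2))%:E
  | B11 => (Num.sqrt (nu ^+ 2 + x ^+ 2)
            + Num.sqrt ((nu + lam) ^+ 2 + x ^+ 2) - lam)%:E
  | B20 => (esqrt_ratio (nu - 2 * lam)%R (nu - lam)%R x
            + esqrt_ratio nu (nu + lam)%R x + (2 * lam)%:E)%E
  | B12 => (nu + lam / 2 + Num.sqrt ((nu - lam / 2) ^+ 2 + x ^+ 2)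
            + x ^+ 2 / (nu + lam / 2
                        + Num.sqrt ((nu + 3 * lam / 2) ^+ 2 + x ^+ 2)))%:E
  | B21 => (nu - lam + Num.sqrt ((nu + lam) ^+ 2 + x ^+ 2)
            + x ^+ 2 / (nu + Num.sqrt ((nu - 2 * lam) ^+ 2 + x ^+ 2)))%:E
  | B30 => (nu + 2 * lam
            + Num.sqrt ((nu - 2 * lam) ^+ 2
                        + (nu - 2 * lam) / (nu - lam) * x ^+ 2)
            + x ^+ 2 / (nu + lam
                        + Num.sqrt ((nu + 3 * lam) ^+ 2
                            + (nu + 3 * lam) / (nu + 2 * lam) * x ^+ 2)))%:E
  | B03 => (nu - lam / 2 + Num.sqrt (nu ^+ 2 - 1 / 4 + x ^+ 2)
            + x ^+ 2 / (nu - lam / 2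
                        + Num.sqrt ((nu - lam) ^+ 2 - 1 / 4 + x ^+ 2)))%:E
  end.

Definition boundF {R : realType} (pq : bound_label) (lam nu x : R) : \bar R :=
  ((denF pq lam nu x)^-1)%E.

(* Main.v *)
(* With y = x^2/4, write I_v(x) = (x/2)^v C_v(y), K_v(x) = (2/x)^v G_v(y) / 2,
   where C_v is the Bessel-Clifford function and G_v the extended gamma function
   G_v(y) = int_R exp (v t - e^t - y e^(-t)) dt, so that G_v(0) = Gamma(v).
   Then C_v' = C_(v+1), G_v' = - G_(v-1), and both families satisfy a three-term
   recurrence.  The Wronskian relation C_v G_(v+1) + y C_(v+1) G_v = 1 gives
     1 / (I_v K_v) = k_v + x^2 / h_(v+1) = h_v + x^2 / k_(v-1) = h_v + k_v - 2 v
   with h_v = x I_(v-1) / I_v and k_v = x K_(v+1) / K_v.  The ratios h_v and k_v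
   solve Riccati equations, hence are compared with al + sqrt (D + g x^2) by
   looking at the sign of the Riccati defect of the latter, from x = 0 for h_v
   and from x = +oo for k_v.  The recurrences turn a bound on h_(v+1) or k_(v-1)
   into one on h_v or k_v, and all nine pairs of bounds come from inserting two
   bounds of this kind into the formulas for 1 / (I_v K_v). *)
Require Import Defs.
From HB Require Import structures.
From mathcomp Require Import all_boot all_order all_algebra.
From mathcomp Require Import all_classical all_reals all_analysis.
From mathcomp Require Import measurable_realfun ring lra.

Set Implicit Arguments.
Unset Strict Implicit.
Unset Printing Implicit Defensive.

Import Order.TTheory GRing.Theory Num.Theory.
Import numFieldNormedType.Exports.

Local Open Scope classical_set_scope.
Local Open Scope ring_scope.

(** * Linear differential inequalities *)

Section derivative_at_one_sided_minimum.
Context {R : realType}.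
Implicit Types (E : R -> R) (c l : R).

Lemma is_derive_right_min_ge0 E c l : is_derive c (1 : R) E l ->
  (\forall t \near c^'+, E c <= E t) -> 0 <= l.
Proof.
move=> [dE <-] [e /= e0 cmin].
have quot : h^-1 *: (E (h *: 1 + c) - E c) @[h --> 0^'+] --> 'D_1 E c.
  exact: cvg_dnbhs_at_right dE.
rewrite -(cvg_lim _ quot)//; apply: limr_ge; first exact: cvgP quot.
exists e => //= h; rewrite /ball_/= sub0r normrN => he h0.
rewrite mulr_ge0 ?invr_ge0 ?(ltW h0)// subr_ge0 scaler1; apply: cmin => /=.
  by rewrite opprD addrCA subrr addr0 normrN.
by rewrite ltrDr.
Qed.

Lemma is_derive_left_min_le0 E c l : is_derive c (1 : R) E l ->
  (\forall t \near c^'-, E c <= E t) -> l <= 0.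
Proof.
move=> dE cmin; rewrite -oppr_ge0.
have dEN : is_derive (- c) (1 : R) (E \o -%R) (- l).
  have dN : is_derive (- c) (1 : R) (-%R : R -> R) (-1) by exact: is_deriveNid.
  rewrite -[- l]mulrN1; apply: is_derive1_comp => //.
  by rewrite opprK.
apply: is_derive_right_min_ge0 dEN _.
by rewrite at_rightN; apply: filterS cmin => t Ect; rewrite /= !opprK.
Qed.

End derivative_at_one_sided_minimum.

Section linear_differential_inequalities.
Context {R : realType}.
Variables E E' : R -> R.
Implicit Types y z : R.
Hypothesis dE : forall y, 0 < y -> is_derive y (1 : R) E (E' y).

Let continuous_within_pos (a b : R) : 0 < a -> {within `[a, b], continuous E}.
Proof.
move=> a0; apply: derivable_within_continuous => c.
by rewrite in_itv/= => /andP[ac _]; case: (dE (lt_le_trans a0 ac)).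
Qed.

Lemma gronwall (M a b : R) : 0 < a -> a <= b ->
  (forall y, y \in `]a, b[ -> - (M * E y) <= E' y) ->
  E a * expR (M * a) <= E b * expR (M * b).
Proof.
move=> a0 ab E'_ge; pose T y : R := E y * expR (M * y).
have dT y : 0 < y -> is_derive y (1 : R) T (expR (M * y) * (E' y + M * E y)).
  move=> y0; have dEy := dE y0.
  have -> : T = E * (expR \o (M \*: id)) by [].
  by apply: is_derive_eq; rewrite /GRing.scale/=; ring.
apply: (@ger0_derive1_le_cc _ T a b); rewrite ?in_itv/= ?lexx ?ab//.
- by move=> y; rewrite in_itv/= => /andP[ay _]; case: (dT y (lt_trans a0 ay)).
- move=> y yab; have := yab; rewrite in_itv/= => /andP[/(lt_trans a0)/dT dTy _].
  by rewrite derive1E derive_val mulr_ge0 ?expR_ge0// -lerBlDr sub0r E'_ge.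
- apply: derivable_within_continuous => y; rewrite in_itv/= => /andP[ay _].
  by case: (dT y (lt_le_trans a0 ay)).
Qed.

Section from_zero.
Hypothesis cE : continuous E.

Lemma ge0_of_initial_ge0 : 0 <= E 0 ->
  (forall y, 0 < y -> E y < 0 -> 0 < E' y) -> forall y, 0 < y -> 0 <= E y.
Proof.
move=> E0 E'_gt0 y y0; rewrite leNgt; apply/negP => Ey.
have [c] := EVT_min (ltW y0) (continuous_subspaceT cE).
rewrite in_itv/= => /andP[c_ge0 cy] cmin.
have Ec : E c < 0.
  by apply: le_lt_trans Ey; apply: cmin; rewrite in_itv/= lexx ltW.
have c0 : 0 < c.
  by rewrite lt_def c_ge0 andbT; apply: contraTneq Ec => ->; rewrite -leNgt.
suff : E' c <= 0 by rewrite leNgt E'_gt0.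
apply: is_derive_left_min_le0 (dE c0) _.
near=> t; apply: cmin; rewrite in_itv/=; apply/andP; split.
  by apply: ltW; near: t; exact: nbhs_left_gt.
by apply: (le_trans _ cy); near: t; exact: nbhs_left_le.
Unshelve. all: by end_near. Qed.

Lemma gt0_of_initial_ge0 : 0 <= E 0 ->
  (forall y, 0 < y -> E y <= 0 -> 0 < E' y) -> forall y, 0 < y -> 0 < E y.
Proof.
move=> E0 E'_gt0.
have E_ge0 : forall y, 0 < y -> 0 <= E y.
  by apply: ge0_of_initial_ge0 => // y y0 /ltW; exact: E'_gt0.
move=> y y0; rewrite lt_def E_ge0// andbT; apply/eqP => Ey.
suff : E' y <= 0 by rewrite leNgt E'_gt0// Ey.
apply: is_derive_left_min_le0 (dE y0) _.
by near=> t; rewrite Ey E_ge0//; near: t; exact: nbhs_left_gt.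
Unshelve. all: by end_near. Qed.

Lemma gt0_of_initial_gt0 (p : R -> R) : 0 < E 0 ->
  (forall y, 0 < y -> 0 < p y) ->
  (forall y, 0 < y -> {for y, continuous p}) ->
  (forall y, 0 < y -> - (p y * E y) <= E' y) -> forall y, 0 < y -> 0 < E y.
Proof.
move=> E0 p_gt0 cp E'_ge y y0.
have E_ge0 : forall z, 0 < z -> 0 <= E z.
  apply: ge0_of_initial_ge0 => [|z z0 Ez]; first exact: ltW.
  by apply: lt_le_trans (E'_ge z z0); rewrite oppr_gt0 pmulr_rlt0 ?p_gt0.
have [a [a0 ay Ea]] : exists a, [/\ 0 < a, a < y & 0 < E a].
  have : E t @[t --> 0^'+] --> E 0 by apply: cvg_at_right_filter; exact: cE.
  move=> /cvgr_gt /(_ _ E0) Enear.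
  near (at_right (0 : R)) => a; exists a; split; near: a.
  - exact: nbhs_right_gt.
  - exact: nbhs_right_lt.
  - exact: Enear.
have cpa : {within `[a, y], continuous p}.
  apply: continuous_in_subspaceT => z; rewrite inE/= in_itv/= => /andP[az _].
  by apply: cp; exact: lt_le_trans az.
have [m _ p_le] := EVT_max (ltW ay) cpa.
rewrite -(@pmulr_lgt0 _ (expR (p m * y))) ?expR_gt0//.
apply: (@lt_le_trans _ _ (E a * expR (p m * a))).
  by rewrite mulr_gt0 ?expR_gt0.
apply: gronwall (ltW ay) _ => // z; rewrite in_itv/= => /andP[az zy].
have z0 := lt_trans a0 az; apply: le_trans (E'_ge z z0).
by rewrite lerN2 ler_wpM2r ?E_ge0// p_le// in_itv/= !ltW.
Unshelve. all: by end_near. Qed.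

End from_zero.

Lemma ge0_of_cvgy0 : E y @[y --> +oo] --> 0 ->
  (forall y, 0 < y -> E y < 0 -> E' y < 0) -> forall y, 0 < y -> 0 <= E y.
Proof.
move=> Ey0 E'_lt0 y y0; rewrite leNgt; apply/negP => Ey.
suff E_le z : y <= z -> E z <= E y.
  suff : 0 <= E y by rewrite leNgt Ey.
  rewrite -(cvg_lim _ Ey0)//; apply: limr_le; first exact: cvgP Ey0.
  by near=> z; apply: E_le; near: z; apply: nbhs_pinfty_ge; exact: num_real.
move=> yz; have [c] := EVT_min yz (continuous_within_pos y0).
rewrite in_itv/= => /andP[yc]; rewrite le_eqVlt => /predU1P[->|cz] cmin.
  by apply: cmin; rewrite in_itv/= lexx.
have Ec : E c < 0.
  by apply: le_lt_trans Ey; apply: cmin; rewrite in_itv/= lexx.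
have c0 := lt_le_trans y0 yc.
suff : 0 <= E' c by rewrite leNgt E'_lt0.
apply: is_derive_right_min_ge0 (dE c0) _.
near=> t; apply: cmin; rewrite in_itv/=; apply/andP; split.
  by apply: (le_trans yc); near: t; exact: nbhs_right_ge.
by apply: ltW; near: t; exact: nbhs_right_lt.
Unshelve. all: by end_near. Qed.

End linear_differential_inequalities.

(** * Integration *)

Lemma integrable_nondecreasing_set_cvg_integral d (T : measurableType d)
    (R : realType) (mu : {measure set T -> \bar R}) (F : (set T)^nat)
    (f : T -> \bar R) :
  nondecreasing_seq F -> (forall n, measurable (F n)) ->
  mu.-integrable (\bigcup_n F n) f ->
  (\int[mu]_(x in F n) f x)%E @[n --> \oo] -->
    (\int[mu]_(x in \bigcup_n F n) f x)%E.
Proof.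
move=> ndF mF; set D := \bigcup_n F n => fi.
have mD : measurable D by exact: bigcup_measurable.
have mf : measurable_fun D f by case/integrableP : fi.
have FD n : F n `<=` D by exact: bigcup_sup.
under eq_cvg => n do rewrite -[F n](setIidr (FD n)) integral_mkcondr.
have [] := @dominated_convergence _ _ _ mu D mD (fun n => f \_ (F n)) f
  (fun x => `|f x|%E) => //.
- move=> n; apply: measurable_funTS.
  by apply/(measurable_restrictT _ (mF n)); exact: measurable_funS mf.
- apply: aeW => x [m _ Fmx]; apply: cvg_near_cst; exists m => // n /= mn.
  by rewrite patchE mem_set//; have /subsetPset := ndF _ _ mn; exact.
- exact: integrable_abse.
- apply: aeW => x n _; rewrite patchE; case: ifP => // _.
  by rewrite abse0.
Qed.

Lemma is_derive_under_integral d (T : measurableType d) (R : realType)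
    (mu : {measure set T -> \bar R}) (f f' : R -> T -> R) (G : T -> R)
    (u v a : R) :
  a \in `]u, v[ ->
  (forall x, x \in `]u, v[ -> mu.-integrable [set: T] (EFin \o f x)) ->
  (forall x t, x \in `]u, v[ -> is_derive x (1 : R) (f ^~ t) (f' x t)) ->
  mu.-integrable [set: T] (EFin \o G) ->
  (forall x t, x \in `]u, v[ -> `|f' x t| <= G t) ->
  is_derive a (1 : R) (fun x => \int[mu]_t f x t) (\int[mu]_t f' a t).
Proof.
move=> a_uv intf df intG f'_le.
have derf x t : `]u, v[%classic x -> [set: T] t -> derivable (f ^~ t) x 1.
  by move=> x_uv _; case: (df x t x_uv).
have d1f x t : x \in `]u, v[ -> partial1of2 f x t = f' x t.
  by move=> x_uv; rewrite partial1of2E; case: (df x t x_uv).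
have G_ge0 t : 0 <= G t by exact: le_trans (f'_le a t a_uv).
have d1f_le x t : `]u, v[%classic x -> [set: T] t ->
    `|partial1of2 f x t| <= G t.
  by move=> x_uv _; rewrite d1f// f'_le.
have mT : measurable [set: T] by exact: measurableT.
apply: DeriveDef.
  exact: (derivable_under_integral mT a_uv intf derf G_ge0 intG d1f_le).
rewrite -derive1E.
rewrite (differentiation_under_integral mT a_uv intf derf G_ge0 intG d1f_le).
by apply: eq_Rintegral => t _; rewrite d1f.
Qed.

Section integration_on_the_line.
Context {R : realType}.
Notation mu := (@lebesgue_measure R).
Implicit Types (f F : R -> R) (c l m t : R).

Definition symm_itv (n : nat) : set R := `[- n%:R, n%:R]%classic.

Lemma nondecreasing_symm_itv : nondecreasing_seq symm_itv.
Proof.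
move=> m n mn; apply/subsetPset => t; rewrite /symm_itv/= !in_itv/= -!ler_norml.
by move=> /le_trans; apply; rewrite ler_nat.
Qed.

Lemma bigcup_symm_itv : \bigcup_n symm_itv n = [set: R].
Proof.
rewrite -subTset => t _; exists (Num.truncn `|t|).+1 => //=.
by rewrite /symm_itv/= in_itv/= -ler_norml ltW// truncnS_gt.
Qed.

Lemma continuous_is_derive F f :
  (forall t, is_derive t (1 : R) F (f t)) -> continuous F.
Proof.
move=> dF t; apply/differentiable_continuous/derivable1_diffP.
by case: (dF t).
Qed.

Lemma integral_symm_itv_derivative F f n :
  (forall t, is_derive t (1 : R) F (f t)) -> continuous f -> (0 < n)%N ->
  (\int[mu]_(t in symm_itv n) (f t)%:E = (F n%:R - F (- n%:R))%:E)%E.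
Proof.
move=> dF cf n0; have nR : 0 < n%:R :> R by rewrite ltr0n.
rewrite (@continuous_FTC2 _ _ F) -?EFinB//; first by lra.
- exact: continuous_subspaceT.
- have cF := continuous_is_derive dF.
  split; first by move=> t _; case: (dF t).
  + exact: cvg_at_right_filter (cF _).
  + exact: cvg_at_left_filter (cF _).
- by move=> t _; rewrite derive1E; apply: derive_val.
Qed.

Lemma Rintegral_derivative F f l m :
  (forall t, is_derive t (1 : R) F (f t)) -> continuous f ->
  mu.-integrable [set: R] (EFin \o f) ->
  F t @[t --> +oo] --> l -> F t @[t --> -oo] --> m ->
  \int[mu]_t f t = l - m.
Proof.
move=> dF cf fi Fl /cvgNy_compNP Fm; rewrite /Rintegral -bigcup_symm_itv.
have /cvg_lim <- // : (\int[mu]_(t in symm_itv n) (f t)%:E)%E @[n --> \oo] -->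
    (\int[mu]_(t in \bigcup_n symm_itv n) (f t)%:E)%E.
  apply: integrable_nondecreasing_set_cvg_integral => [|n|].
  - exact: nondecreasing_symm_itv.
  - exact: measurable_itv.
  - by rewrite bigcup_symm_itv.
suff /cvg_lim -> // : (\int[mu]_(t in symm_itv n) (f t)%:E)%E @[n --> \oo]
    --> (l - m)%:E by [].
apply: (@cvg_trans _ ((F n%:R - (F \o -%R) n%:R)%:E @[n --> \oo])).
  apply: near_eq_cvg; near=> n.
  rewrite (integral_symm_itv_derivative dF)//; near: n; exact: nbhs_infty_gt.
apply: cvg_EFin; first exact: nearW.
by apply: cvgB; [apply: cvg_comp Fl|apply: cvg_comp Fm]; exact: cvgr_idn.
Unshelve. all: by end_near. Qed.

Lemma Rintegral_gt0 f : (forall t, 0 < f t) -> continuous f ->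
  mu.-integrable [set: R] (EFin \o f) -> 0 < \int[mu]_t f t.
Proof.
move=> f0 cf fi.
have [m _ f_ge] := EVT_min (@ler01 R) (continuous_subspaceT cf).
have mf : measurable_fun [set: R] (EFin \o f) by case/integrableP : fi.
have int_ge : ((f m)%:E <= \int[mu]_t (f t)%:E)%E.
  apply: (@le_trans _ _ (\int[mu]_(t in `[0%R, 1%R]) (f t)%:E)%E); last first.
    by apply: ge0_subset_integral => // t _; rewrite lee_fin ltW.
  have -> : (f m)%:E = (\int[mu]_(t in `[0%R, 1%R]) (f m)%:E)%E.
    by rewrite integral_cst//= lebesgue_measure_itv/= lte01 sube0 mule1.
  apply: ge0_le_integral => //=; last exact: measurable_funTS.
  by move=> t _; rewrite lee_fin ltW.
rewrite /Rintegral fine_gt0// (lt_le_trans _ int_ge) ?lte_fin//=.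
by rewrite ltey_eq (integrable_fin_num _ fi).
Qed.

Lemma integrable_expR_normr c : 0 < c ->
  mu.-integrable [set: R] (EFin \o (fun t => expR (- (c * `|t|)))).
Proof.
move=> c0; set f := fun t => _.
have cf : continuous f.
  move=> t; apply: continuous_comp; last exact: continuous_expR.
  by apply: cvgN; apply: cvgM; [exact: cvg_cst|exact: norm_continuous].
have f_ge0 t : 0 <= f t by exact: expR_ge0.
have mpdf : measurable_fun [set: R] (EFin \o exponential_pdf c).
  by apply/measurable_EFinP; exact: measurable_exponential_pdf.
have pdf_ge0 t : (0 <= (exponential_pdf c t)%:E)%E.
  by rewrite lee_fin exponential_pdf_ge0// ltW.
apply/integrableP; split.
  by apply/measurable_EFinP; exact: continuous_measurable_fun.
under eq_integral do rewrite /= ger0_norm//.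
rewrite ge0_symfun_integralT//; last by move=> t; rewrite /f/= normrN.
rewrite -set_itvcy lte_mul_pinfty//.
rewrite (@eq_integral _ _ _ mu _
  (fun t => c^-1%:E * (exponential_pdf c t)%:E)%E); last first.
  move=> t; rewrite inE/= in_itv/= andbT => t0.
  rewrite -EFinM exponential_pdfE// mulKf ?gt_eqF//.
  by rewrite /f ger0_norm// mulNr.
rewrite ge0_integralZl ?lee_fin ?invr_ge0 ?(ltW c0)//; last first.
  exact: measurable_funTS.
rewrite lte_mul_pinfty ?lee_fin ?invr_ge0 ?(ltW c0)//.
apply: (@le_lt_trans _ _ (\int[mu]_t (exponential_pdf c t)%:E)%E).
  exact: ge0_subset_integral.
by rewrite integral_exponential_pdf// ltry.
Qed.

Lemma integral_translate f c : (forall t, 0 <= f t) -> continuous f ->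
  (\int[mu]_t (f (t + c))%:E = \int[mu]_t (f t)%:E)%E.
Proof.
move=> f0 cf; pose F t := t + c.
have dF t : is_derive t (1 : R) F 1.
  by have -> : F = id + cst c by []; apply: is_derive_eq; rewrite addr0.
have F1 : F^`()%classic = cst 1.
  by apply/funext => t; rewrite derive1E; apply: derive_val.
rewrite [RHS](@increasing_ge0_integration_by_substitutionT _ F)//.
- by apply: eq_integral => t _; rewrite F1/= fctE/= mulr1.
- by move=> a b; rewrite /F ltrD2r.
- by rewrite F1; exact: cst_continuous.
- by rewrite F1; exact: is_cvg_cst.
- by rewrite F1; exact: is_cvg_cst.
- exact: cvg_addrr_Ny.
- exact: cvg_addrr.
Qed.

Lemma ge0_integral_fold f : (forall t, 0 <= f t) -> continuous f ->
  (\int[mu]_t (f t)%:E = \int[mu]_(t in `[0%R, +oo[) (f t + f (- t))%:E)%E.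
Proof.
move=> f0 cf.
have mf : measurable_fun [set: R] (EFin \o f).
  by apply/measurable_EFinP; exact: continuous_measurable_fun.
have mfN : measurable_fun [set: R] (EFin \o (f \o -%R)).
  by apply/measurable_EFinP; apply: measurableT_comp;
    [exact: continuous_measurable_fun|].
under [RHS]eq_integral do rewrite EFinD.
rewrite ge0_integralD//=; first last.
- exact: measurable_funTS mfN.
- by move=> t _; rewrite lee_fin.
- exact: measurable_funTS mf.
- by move=> t _; rewrite lee_fin.
rewrite -(setUv (`[0%R, +oo[%classic : set R)) ge0_integral_setU//=;
  last 4 first.
- exact: measurableC.
- by rewrite setUv.
- by move=> t _; rewrite lee_fin.
- exact/disj_setPCl.
congr (_ + _)%E.
rewrite setCitvr integral_itv_bndo_bndc; last exact: measurable_funTS mf.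
rewrite -{1}oppr0 ge0_integration_by_substitutionNy//.
exact: continuous_subspaceT.
Qed.

End integration_on_the_line.

Section substitution_by_expR.
Context {R : realType}.
Notation mu := (@lebesgue_measure R).
Implicit Types (G : R -> R) (n : nat).

Let exp_itv n : set R := `[expR (- n%:R), expR n%:R]%classic.

Let nondecreasing_exp_itv : nondecreasing_seq exp_itv.
Proof.
move=> m n mn; apply/subsetPset => t; rewrite /exp_itv/= !in_itv/=.
have mnR : m%:R <= n%:R :> R by rewrite ler_nat.
by move=> /andP[mt tm]; rewrite (le_trans _ mt) ?(le_trans tm)// ler_expR; lra.
Qed.

Let bigcup_exp_itv : \bigcup_n exp_itv n = `]0, +oo[%classic.
Proof.
apply/seteqP; split=> [t [n _]|t]; rewrite /exp_itv/= !in_itv/= andbT.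
  by case/andP => /(lt_le_trans (expR_gt0 _)).
move=> t0; exists (Num.truncn `|ln t|).+1 => //=; rewrite in_itv/=.
have := ltW (truncnS_gt `|ln t|).
by rewrite ler_norml -ler_expR -[X in _ && X]ler_expR lnK ?posrE.
Qed.

Let integral_exp_itv G n : (forall t, 0 < t -> {for t, continuous G}) ->
  (\int[mu]_(u in exp_itv n) (G u)%:E =
   \int[mu]_(t in symm_itv n) (G (expR t) * expR t)%:E)%E.
Proof.
move=> cG.
have dE : expR^`()%classic = expR :> (R -> R).
  by apply/funext => t; rewrite derive1E; exact: derive_val.
have cexp := @continuous_expR R.
rewrite integration_by_substitution_increasing ?dE//.
- by rewrite ge0_cp// oppr_le0.
- by move=> a b _ _ ab; rewrite ltr_expR.
- exact: cvgP (cvg_at_right_filter (cexp _)).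
- exact: cvgP (cvg_at_left_filter (cexp _)).
- split; first by move=> t _; exact: derivable_expR.
  + exact: cvg_at_right_filter (cexp _).
  + exact: cvg_at_left_filter (cexp _).
- apply: continuous_in_subspaceT => t; rewrite inE/= in_itv/= => /andP[nt _].
  by apply: cG; apply: lt_le_trans nt; exact: expR_gt0.
Qed.

Lemma ge0_integration_by_substitution_expR G :
  (forall t, 0 < t -> {for t, continuous G}) -> (forall t, 0 <= G t) ->
  (\int[mu]_(u in `]0%R, +oo[) (G u)%:E =
   \int[mu]_t (G (expR t) * expR t)%:E)%E.
Proof.
move=> cG G0; rewrite -bigcup_exp_itv -bigcup_symm_itv.
have cGexp : continuous (fun t => G (expR t) * expR t).
  move=> t; apply: cvgM; last exact: continuous_expR.
  apply: continuous_comp; first exact: continuous_expR.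
  by apply: cG; exact: expR_gt0.
have mG n : measurable_fun (exp_itv n) (EFin \o G).
  apply/measurable_EFinP; apply: subspace_continuous_measurable_fun.
    exact: measurable_itv.
  apply: continuous_in_subspaceT => t; rewrite inE /exp_itv/= in_itv/=.
  by move=> /andP[nt _]; apply: cG; apply: lt_le_trans nt; exact: expR_gt0.
have cvg_exp : (\int[mu]_(u in exp_itv n) (G u)%:E)%E @[n --> \oo] -->
    (\int[mu]_(u in \bigcup_n exp_itv n) (G u)%:E)%E.
  apply: ge0_nondecreasing_set_cvg_integral => [|n||n u _].
  - exact: nondecreasing_exp_itv.
  - exact: measurable_itv.
  - exact: mG.
  - by rewrite lee_fin.
have cvg_symm :
    (\int[mu]_(t in symm_itv n) (G (expR t) * expR t)%:E)%E @[n --> \oo] -->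
    (\int[mu]_(t in \bigcup_n symm_itv n) (G (expR t) * expR t)%:E)%E.
  apply: ge0_nondecreasing_set_cvg_integral => [|n|n|n t _].
  - exact: nondecreasing_symm_itv.
  - exact: measurable_itv.
  - apply: measurable_funTS; apply/measurable_EFinP.
    exact: continuous_measurable_fun.
  - by rewrite lee_fin mulr_ge0 ?expR_ge0.
rewrite -(cvg_lim _ cvg_exp)// -(cvg_lim _ cvg_symm)//.
by congr (lim (_ @ \oo)); apply/funext => n; exact: integral_exp_itv.
Qed.

End substitution_by_expR.

(** * The extended gamma function *)

Definition extGamma_kernel (R : realType) (p y t : R) : R :=
  expR (p * t - expR t - y * expR (- t)).

(* The extended gamma function G_p(y) of Chaudhry and Zubair,
   int_0^oo u^(p-1) exp (- u - y/u) du, after the substitution u = exp t. *)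
HB.lock Definition extGamma (R : realType) (p y : R) : R :=
  \int[lebesgue_measure]_t extGamma_kernel p y t.
Arguments extGamma {R} p y.

Definition extGamma_dom (R : realType) (p y : R) : bool :=
  (0 < y) || ((0 < p) && (0 <= y)).

Section extGamma_kernel_theory.
Context {R : realType}.
Notation mu := (@lebesgue_measure R).
Implicit Types p q c y z t : R.

Lemma extGamma_kernel_gt0 p y t : 0 < extGamma_kernel p y t.
Proof. exact: expR_gt0. Qed.

Lemma extGamma_kernel_addl p q y t :
  extGamma_kernel (p + q) y t = extGamma_kernel p y t * expR (q * t).
Proof. by rewrite /extGamma_kernel -expRD; congr expR; ring. Qed.

Lemma extGamma_kernel_addr p y z t :
  extGamma_kernel p (y + z) t =
  extGamma_kernel p y t * expR (- (z * expR (- t))).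
Proof. by rewrite /extGamma_kernel -expRD; congr expR; ring. Qed.

Lemma extGamma_kernel_le p y z t : y <= z ->
  extGamma_kernel p z t <= extGamma_kernel p y t.
Proof.
by move=> yz; rewrite ler_expR lerD2l lerN2 ler_wpM2r// expR_ge0.
Qed.

Lemma is_derive_extGamma_kernel p y t :
  is_derive t (1 : R) (extGamma_kernel p y)
    (p * extGamma_kernel p y t - extGamma_kernel (p + 1) y t
     + y * extGamma_kernel (p - 1) y t).
Proof.
have -> : extGamma_kernel p y =
  expR \o ((p \*: id) - expR - (y \*: (expR \o -%R)))%R by [].
apply: is_derive_eq; rewrite !extGamma_kernel_addl mul1r mulN1r.
by rewrite /extGamma_kernel /GRing.scale/=; ring.
Qed.

Lemma is_derive_extGamma_kernel_param p y t :
  is_derive y (1 : R) (fun z => extGamma_kernel p z t)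
    (- extGamma_kernel (p - 1) y t).
Proof.
have -> : (fun z => extGamma_kernel p z t) =
  expR \o (cst (p * t - expR t) - (expR (- t) \*: id)).
  apply/funext => z.
  by rewrite /extGamma_kernel !fctE/= /GRing.scale/= [z * _]mulrC.
apply: is_derive_eq; rewrite extGamma_kernel_addl mulN1r.
by rewrite /extGamma_kernel /GRing.scale/= [y * _]mulrC; ring.
Qed.

Lemma continuous_extGamma_kernel p y : continuous (extGamma_kernel p y).
Proof. exact: continuous_is_derive (is_derive_extGamma_kernel p y). Qed.

Lemma linear_sub_expR_le p c t : 0 < p -> 0 < c ->
  p * t - c * expR t <= p * ln (p / c) - p.
Proof.
move=> p0 c0.
have pc0 : 0 < p / c by rewrite divr_gt0.
have -> : c * expR t = p * expR (t - ln (p / c)).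
  by rewrite expRB lnK ?posrE//; field; rewrite !gt_eqF.
have := expR_ge1Dx (t - ln (p / c)).
by rewrite -(ler_pM2l p0); lra.
Qed.

Lemma extGamma_exponent_le p y : extGamma_dom p y -> exists c K : R, 0 < c /\
  forall t, p * t - expR t - y * expR (- t) <= K - c * `|t|.
Proof.
move=> /orP[y0|/andP[p0 y0]].
  pose q := `|p| + 1; pose m := Num.min 1 y.
  have q0 : 0 < q by rewrite ltr_wpDl.
  have m0 : 0 < m by rewrite lt_min ltr01.
  have m1 : m <= 1 by rewrite ge_min lexx.
  have my : m <= y by rewrite ge_min lexx orbT.
  exists 1, (q * ln (q / m) - q); split => // t.
  have := linear_sub_expR_le `|t| q0 m0; rewrite {1}/q => t_le.
  have pt : p * t <= `|p| * `|t| by rewrite -normrM ler_norm.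
  suff : m * expR `|t| <= expR t + y * expR (- t) by lra.
  have et := expR_ge0 t; have eNt := expR_ge0 (- t).
  by have [t0|t0] := leP 0 t; [rewrite ger0_norm//|rewrite ltr0_norm//]; nra.
have p20 : 0 < 2 * p by lra.
pose K := 2 * p * ln (2 * p / 1) - 2 * p.
exists p, `|K|; split => // t.
have t_le := linear_sub_expR_le t p20 ltr01; rewrite mul1r -/K in t_le.
have yt : 0 <= y * expR (- t) by rewrite mulr_ge0 ?expR_ge0.
have := expR_ge0 t; have := ler_norm K; have := normr_ge0 K.
have [t0|t0] := leP 0 t; first by rewrite (ger0_norm t0); lra.
by rewrite (ltr0_norm t0); nra.
Qed.

Lemma extGamma_kernel_le_expR_normr p y : extGamma_dom p y ->
  exists c C : R, 0 < c /\
    forall t, extGamma_kernel p y t <= C * expR (- (c * `|t|)).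
Proof.
move=> /extGamma_exponent_le[c [K [c0 le_K]]].
exists c, (expR K); split => // t.
by rewrite -expRD ler_expR le_K.
Qed.

Lemma integrable_extGamma_kernel p y : extGamma_dom p y ->
  mu.-integrable [set: R] (EFin \o extGamma_kernel p y).
Proof.
move=> /extGamma_kernel_le_expR_normr[c [C [c0 le_C]]].
apply: (@le_integrable _ _ _ mu _ measurableT _
  (fun t => (C%:E * (expR (- (c * `|t|)))%:E)%E)).
- by apply/measurable_EFinP; apply: continuous_measurable_fun;
    exact: continuous_extGamma_kernel.
- move=> t _; rewrite lee_fin ger0_norm ?expR_ge0//.
  exact: le_trans (le_C t) (ler_norm _).
- by apply: integrableZl => //; exact: integrable_expR_normr.
Qed.

Lemma cvgy_extGamma_kernel p y : extGamma_dom p y ->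
  extGamma_kernel p y t @[t --> +oo] --> 0 /\
  extGamma_kernel p y t @[t --> -oo] --> 0.
Proof.
move=> /extGamma_kernel_le_expR_normr[c [C [c0 le_C]]].
have C_cvg : C * expR (- (c * t)) @[t --> +oo] --> 0.
  rewrite -(mulr0 C); apply: cvgM; first exact: cvg_cst.
  exact: cvg_comp (gt0_cvgMry c0 cvg_id) (@cvgr_expR R).
split; last apply/cvgNy_compNP;
  apply: (squeeze_cvgr _ (cvg_cst 0) C_cvg); near=> t;
  rewrite ?fctE/= (ltW (extGamma_kernel_gt0 _ _ _))/=;
  apply: le_trans (le_C _) _; rewrite ?normrN ger0_norm//;
  near: t; apply: nbhs_pinfty_ge; exact: num_real.
Unshelve. all: by end_near. Qed.

End extGamma_kernel_theory.

Section extGamma_theory.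
Context {R : realType}.
Notation mu := (@lebesgue_measure R).
Implicit Types p y z : R.

Lemma extGamma_dom_gt0 p y : 0 < y -> extGamma_dom p y.
Proof. by rewrite /extGamma_dom => ->. Qed.

Lemma extGamma_dom_ge0 p y : 0 < p -> 0 <= y -> extGamma_dom p y.
Proof. by rewrite /extGamma_dom => -> ->; rewrite orbT. Qed.

Lemma extGamma_gt0 p y : extGamma_dom p y -> 0 < extGamma p y.
Proof.
move=> D; rewrite extGamma.unlock; apply: Rintegral_gt0.
- exact: extGamma_kernel_gt0.
- exact: continuous_extGamma_kernel.
- exact: integrable_extGamma_kernel.
Qed.

Lemma extGamma_le p y z : extGamma_dom p y -> y <= z ->
  extGamma p z <= extGamma p y.
Proof.
move=> D yz; rewrite extGamma.unlock; apply: le_Rintegral => //.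
- apply: integrable_extGamma_kernel; move: D => /orP[y0|/andP[p0 y0]].
    exact/extGamma_dom_gt0/(lt_le_trans y0).
  exact: extGamma_dom_ge0 p0 (le_trans y0 yz).
- exact: integrable_extGamma_kernel.
- by move=> t _; exact: extGamma_kernel_le.
Qed.

Lemma Rintegral_mulr_extGamma_kernel_pred p y : extGamma_dom p y ->
  mu.-integrable [set: R]
    (EFin \o (fun t => y * extGamma_kernel (p - 1) y t)) /\
  \int[mu]_t (y * extGamma_kernel (p - 1) y t) = y * extGamma (p - 1) y.
Proof.
move=> D; have [->|y_neq0] := eqVneq y 0.
  under eq_fun do rewrite mul0r.
  by rewrite mul0r Rintegral_cst// mul0r; split => //; exact: integrable0.
have I : mu.-integrable [set: R] (EFin \o extGamma_kernel (p - 1) y).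
  apply/integrable_extGamma_kernel/extGamma_dom_gt0.
  by move: D => /orP[//|/andP[_]]; rewrite lt_def y_neq0.
rewrite extGamma.unlock RintegralZl//; split => //.
exact: (integrableZl measurableT y I).
Qed.

(* The integral over the line of the derivative of the kernel vanishes. *)
Lemma extGamma_rec p y : extGamma_dom p y ->
  extGamma (p + 1) y = p * extGamma p y + y * extGamma (p - 1) y.
Proof.
move=> D; have [ky kNy] := cvgy_extGamma_kernel D.
have Ik := integrable_extGamma_kernel D.
have IkS : mu.-integrable [set: R] (EFin \o extGamma_kernel (p + 1) y).
  apply: integrable_extGamma_kernel.
  move: D => /orP[y0|/andP[p0 y0]]; first exact: extGamma_dom_gt0.
  by apply: extGamma_dom_ge0 => //; lra.
have [Iyk yk_int] := Rintegral_mulr_extGamma_kernel_pred D.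
have Ipk : mu.-integrable [set: R]
    (EFin \o (fun t => p * extGamma_kernel p y t)).
  exact: (integrableZl measurableT p Ik).
have Ipk_kS : mu.-integrable [set: R] (EFin \o
    (fun t => p * extGamma_kernel p y t - extGamma_kernel (p + 1) y t)).
  exact: (integrableB measurableT Ipk IkS).
suff : p * extGamma p y - extGamma (p + 1) y + y * extGamma (p - 1) y = 0.
  by lra.
rewrite -yk_int extGamma.unlock -RintegralZl// -RintegralB// -RintegralD//.
rewrite -[RHS](subrr 0); apply: Rintegral_derivative ky kNy.
- exact: is_derive_extGamma_kernel.
- have ck q := @continuous_extGamma_kernel R q y.
  move=> t; apply: cvgD; last by apply: cvgM; [exact: cvg_cst|exact: ck].
  by apply: cvgB; [apply: cvgM; [exact: cvg_cst|exact: ck]|exact: ck].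
- exact: (integrableD measurableT Ipk_kS Iyk).
Qed.

Lemma is_derive_extGamma p y : 0 < y ->
  is_derive y (1 : R) (extGamma p) (- extGamma (p - 1) y).
Proof.
move=> y0; have y20 : 0 < y / 2 by rewrite divr_gt0.
have I q z : 0 < z -> mu.-integrable [set: R] (EFin \o extGamma_kernel q z).
  by move=> z0; exact/integrable_extGamma_kernel/extGamma_dom_gt0.
have -> : - extGamma (p - 1) y = \int[mu]_t - extGamma_kernel (p - 1) y t.
  rewrite extGamma.unlock -[LHS]mulN1r -RintegralZl//; last exact: I.
  by apply: eq_Rintegral => t _; rewrite mulN1r.
rewrite extGamma.unlock.
apply: (@is_derive_under_integral _ _ _ mu _
  (fun z t => - extGamma_kernel (p - 1) z t) (extGamma_kernel (p - 1) (y / 2))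
  (y / 2) (y + 1)).
- by rewrite in_itv/=; apply/andP; split; lra.
- by move=> z; rewrite in_itv/= => /andP[yz _]; apply: I; exact: lt_trans yz.
- by move=> z t _; exact: is_derive_extGamma_kernel_param.
- exact: I.
- move=> z t; rewrite in_itv/= => /andP[/ltW yz _].
  by rewrite normrN gtr0_norm ?extGamma_kernel_gt0// extGamma_kernel_le.
Qed.

(* Convexity of the kernel in y: its tangent at y = 0 lies below it. *)
Lemma extGamma_sub_le p y : 1 < p -> 0 <= y ->
  extGamma p 0 - y * extGamma (p - 1) 0 <= extGamma p y.
Proof.
move=> p1 y0; have p0 : 0 < p by lra.
have I0 : mu.-integrable [set: R] (EFin \o extGamma_kernel p 0).
  exact/integrable_extGamma_kernel/extGamma_dom_ge0.
have I1 : mu.-integrable [set: R] (EFin \o extGamma_kernel (p - 1) 0).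
  by apply/integrable_extGamma_kernel/extGamma_dom_ge0 => //; lra.
have I1y : mu.-integrable [set: R]
    (EFin \o (fun t => y * extGamma_kernel (p - 1) 0 t)).
  exact: (integrableZl measurableT y I1).
rewrite extGamma.unlock -RintegralZl// -RintegralB//; apply: le_Rintegral => //.
- exact: (integrableB measurableT I0 I1y).
- exact/integrable_extGamma_kernel/extGamma_dom_ge0.
move=> t _; rewrite extGamma_kernel_addl mulN1r -[in leRHS](add0r y).
rewrite extGamma_kernel_addr.
have := expR_ge1Dx (- (y * expR (- t))); have := extGamma_kernel_gt0 p 0 t; nra.
Qed.

Lemma extGamma_cvg_at0 p : 1 < p -> extGamma p y @[y --> 0^'+] --> extGamma p 0.
Proof.
move=> p1.
apply: (@squeeze_cvgr _ _ _ _ (fun y => extGamma p 0 - y * extGamma (p - 1) 0)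
  (cst (extGamma p 0))).
- near=> y; have y0 : 0 <= y by apply: ltW; near: y; exact: nbhs_right_gt.
  rewrite extGamma_sub_le//= extGamma_le//.
  by apply: extGamma_dom_ge0 => //; lra.
- rewrite -[X in _ --> X]subr0 -[X in _ --> _ - X](mul0r (extGamma (p - 1) 0)).
  apply: cvg_at_right_filter; apply: cvgB; first exact: cvg_cst.
  by apply: cvgM; [exact: cvg_id|exact: cvg_cst].
- exact: cvg_cst.
Unshelve. all: by end_near. Qed.

Lemma mulr_extGamma p y : 0 < y ->
  y * extGamma p y = extGamma (p + 1 + 1) y - (p + 1) * extGamma (p + 1) y.
Proof. by move=> y0; rewrite extGamma_rec ?extGamma_dom_gt0// addrK; ring. Qed.

Lemma mulr_extGamma_bounded p :
  exists C : R, forall y, 1 <= y -> `|y * extGamma p y| <= C.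
Proof.
exists (extGamma (p + 1 + 1) 1 + `|p + 1| * extGamma (p + 1) 1) => y y1.
have y0 : 0 < y by lra.
have le1 q : `|extGamma q y| <= extGamma q 1.
  rewrite gtr0_norm ?extGamma_le ?extGamma_gt0//; exact: extGamma_dom_gt0.
rewrite mulr_extGamma// (le_trans (ler_normB _ _))// normrM lerD ?le1//.
by rewrite ler_wpM2l.
Qed.

Lemma extGamma_cvgy p : extGamma p y @[y --> +oo] --> 0.
Proof.
have [C le_C] := mulr_extGamma_bounded p.
apply: (@squeeze_cvgr _ _ _ _ (cst 0) (fun y => C * y^-1)).
- near=> y.
  have y1 : 1 <= y by near: y; apply: nbhs_pinfty_ge; exact: num_real.
  have y0 : 0 < y by lra.
  have g0 := extGamma_gt0 (extGamma_dom_gt0 p y0); rewrite (ltW g0)/=.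
  rewrite ler_pdivlMr// mulrC; apply: le_trans (le_C y y1).
  exact: ler_norm.
- exact: cvg_cst.
- rewrite -(mulr0 C); apply: cvgM; first exact: cvg_cst.
  apply/gtr0_cvgV0; last exact: cvg_id.
  by apply: nbhs_pinfty_gt; exact: num_real.
Unshelve. all: by end_near. Qed.

Lemma mulr_extGamma_cvgy p : y * extGamma p y @[y --> +oo] --> 0.
Proof.
have -> : 0 = 0 - (p + 1) * 0 :> R by rewrite mulr0 subrr.
apply: (@cvg_trans _ (extGamma (p + 1 + 1) y - (p + 1) * extGamma (p + 1) y
    @[y --> +oo])).
  apply: near_eq_cvg; near=> y.
  have y0 : 0 < y by near: y; apply: nbhs_pinfty_gt; exact: num_real.
  by rewrite mulr_extGamma.
apply: cvgB; first exact: extGamma_cvgy.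
by apply: cvgM; [exact: cvg_cst|exact: extGamma_cvgy].
Unshelve. all: by end_near. Qed.

End extGamma_theory.
(** * Gamma and Bessel functions *)

Section Gamma_theory.
Context {R : realType}.
Implicit Types z t : R.

Lemma GammaE z : 0 < z -> Gamma z = extGamma z 0.
Proof.
move=> z0; rewrite /Gamma extGamma.unlock /Rintegral; congr fine.
rewrite ge0_integration_by_substitution_expR.
- apply: eq_integral => t _; congr EFin; rewrite -expRM -!expRD.
  by rewrite /extGamma_kernel; congr expR; ring.
- move=> t t0; apply: cvgM.
    have : derivable (fun s : R => s `^ (z - 1)) t 1.
      by case: (is_derive1_powR (z - 1) t0).
    by move=> /derivable1_diffP/differentiable_continuous.
  by apply: continuous_comp; [exact: continuousN|exact: continuous_expR].
- by move=> t; rewrite mulr_ge0 ?powR_ge0 ?expR_ge0.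
Qed.

Lemma Gamma_gt0 z : 0 < z -> 0 < Gamma z.
Proof. by move=> z0; rewrite GammaE// extGamma_gt0// extGamma_dom_ge0. Qed.

Lemma GammaS z : 0 < z -> Gamma (z + 1) = z * Gamma z.
Proof.
move=> z0; rewrite !GammaE ?extGamma_rec ?mul0r ?addr0//; last by lra.
exact: extGamma_dom_ge0.
Qed.

Lemma rGammaE z : 0 < z -> rGamma z = (Gamma z)^-1.
Proof. by rewrite /rGamma => ->. Qed.

Lemma rGamma_gt0 z : 0 < z -> 0 < rGamma z.
Proof. by move=> z0; rewrite rGammaE// invr_gt0 Gamma_gt0. Qed.

Lemma rGamma_rec z : rGamma z = z * rGamma (z + 1).
Proof.
have [z0|z0] := ltP 0 z.
  have G0 := Gamma_gt0 z0.
  rewrite !rGammaE//; last by lra.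
  by rewrite GammaS//; field; rewrite !gt_eqF.
have nz : 0 <= - z by lra.
have [z1|z1] := ltP 0 (z + 1).
  rewrite (rGammaE z1) /rGamma ltNge z0/=.
  have -> : Num.truncn (- z) = 0%N by apply/eqP; rewrite truncn_eq// nz/=; lra.
  by rewrite big_ord_recl big_ord0/= addr0 mulr1.
rewrite /rGamma !ltNge z0 z1/=.
have -> : Num.truncn (- z) = (Num.truncn (- (z + 1))).+1.
  have nz1 : 0 <= - (z + 1) by lra.
  apply/eqP; rewrite truncn_eq//.
  have /andP[] := truncn_itv nz1.
  by rewrite -!natr1 => n_le lt_n; apply/andP; split; lra.
set n := Num.truncn _.
rewrite big_ord_recl/= addr0 -mulrA; congr (_ * (_ / _)).
  by apply: eq_bigr => i _; rewrite /bump/= natrD; ring.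
by congr Gamma; rewrite -[in LHS]natr1; ring.
Qed.

Lemma rGamma0 : rGamma 0 = 0 :> R.
Proof. by rewrite rGamma_rec mul0r. Qed.

Lemma rGamma_ge0 z : 0 <= z -> 0 <= rGamma z.
Proof.
by rewrite le_eqVlt => /predU1P[<-|/rGamma_gt0/ltW//]; rewrite rGamma0.
Qed.

(* |rGamma| is nonincreasing along z + k as soon as z + k >= 1. *)
Lemma rGamma_bounded z :
  exists C : R, forall k : nat, `|rGamma (z + k%:R)| <= C.
Proof.
have [K zK] : exists K : nat, 1 <= z + K%:R.
  exists (Num.truncn `|z|).+2.
  have := truncnS_gt `|z|; have := ler_norm (- z); rewrite normrN -natr1; lra.
pose r (k : nat) : R := `|rGamma (z + k%:R)|.
exists (\sum_(0 <= i < K.+1) r i) => k; rewrite -/(r k).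
have le_sum (j : nat) : (j <= K)%N -> r j <= \sum_(0 <= i < K.+1) r i.
  move=> jK; rewrite (bigD1_seq j) ?mem_index_iota//; last exact: iota_uniq.
  by rewrite lerDl sumr_ge0// => i _; rewrite normr_ge0.
have [kK|Kk] := leqP k K; first exact: le_sum.
apply: le_trans (le_sum K (leqnn K)).
suff r_le m : r (m + K)%N <= r K by rewrite -(subnK (ltnW Kk)).
elim: m => [|m IH]; first by rewrite add0n.
apply: le_trans IH; rewrite [leRHS]/r rGamma_rec normrM.
have z_ge1 : 1 <= z + (m + K)%:R by rewrite natrD; have := ler0n R m; lra.
have -> : z + (m + K)%:R + 1 = z + (m.+1 + K)%:R by rewrite addSn -natr1; ring.
by rewrite -/(r _) ler_peMl ?normr_ge0// ger0_norm//; lra.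
Qed.

End Gamma_theory.

Section besselK_extGamma.
Context {R : realType}.
Notation mu := (@lebesgue_measure R).
Implicit Types nu x t : R.

Lemma continuous_cosh : continuous (@cosh R).
Proof.
move=> t; apply: cvgM; last exact: cvg_cst.
apply: cvgD; first exact: continuous_expR.
by apply: continuous_comp; [exact: continuousN|exact: continuous_expR].
Qed.

Lemma besselK_integralT nu x :
  besselK nu x = \int[mu]_t (expR (nu * t - x * cosh t) / 2).
Proof.
rewrite /besselK /Rintegral ge0_integral_fold.
- congr fine; apply: eq_integral => t _; congr EFin.
  have -> : cosh (- t) = cosh t by rewrite /cosh opprK addrC.
  rewrite !expRD mulrN mulrC -mulrDl -mulrDl mulrAC; congr (_ * _).
- by move=> t; rewrite divr_ge0 ?expR_ge0.
- move=> t; apply: cvgM; last exact: cvg_cst.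
  apply: continuous_comp; last exact: continuous_expR.
  apply: cvgB; apply: cvgM; try exact: cvg_cst; first exact: cvg_id.
  exact: continuous_cosh.
Qed.

Lemma expR_sub_cosh nu x t : 0 < x ->
  expR (nu * t - x * cosh t) =
  (2 / x) `^ nu * extGamma_kernel nu (x ^+ 2 / 4) (t + ln (x / 2)).
Proof.
move=> x0; have x20 : 0 < x / 2 by rewrite divr_gt0.
have exp_t : expR (t + ln (x / 2)) = expR t * (x / 2).
  by rewrite expRD lnK ?posrE.
have exp_Nt : expR (- (t + ln (x / 2))) = expR (- t) * (2 / x).
  by rewrite opprD expRD [expR (- ln _)]expRN lnK ?posrE// invf_div.
rewrite /powR gt_eqF ?divr_gt0// /extGamma_kernel exp_t exp_Nt -expRD.
rewrite -[in ln (2 / x)]invf_div lnV ?posrE//; congr expR; rewrite /cosh.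
by field; rewrite gt_eqF.
Qed.

Lemma besselKE nu x : 0 < x ->
  besselK nu x = (2 / x) `^ nu * extGamma nu (x ^+ 2 / 4) / 2.
Proof.
move=> x0; rewrite besselK_integralT.
under eq_Rintegral do rewrite expR_sub_cosh// mulrAC.
set k := _ / 2; set y := x ^+ 2 / 4; set c := ln (x / 2).
have y0 : 0 < y by rewrite divr_gt0// exprn_gt0.
pose f t : R := k * extGamma_kernel nu y t.
have f_ge0 t : 0 <= f t by rewrite mulr_ge0 ?divr_ge0 ?powR_ge0 ?expR_ge0.
have cf : continuous f.
  by move=> t; apply: cvgM; [exact: cvg_cst|exact: continuous_extGamma_kernel].
rewrite /Rintegral (integral_translate c f_ge0 cf).
rewrite -/(Rintegral _ _ _) RintegralZl//; last first.
  exact/integrable_extGamma_kernel/extGamma_dom_gt0.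
by rewrite extGamma.unlock mulrAC.
Qed.

End besselK_extGamma.

Definition clifford_coef (R : realType) (v : R) (k : nat) : R :=
  rGamma (v + k%:R + 1) / k`!%:R.

(* The Bessel-Clifford function C_v(y). *)
HB.lock Definition clifford (R : realType) (v y : R) : R :=
  limn (pseries (clifford_coef v) y).
Arguments clifford {R} v y.

Section clifford_theory.
Context {R : realType}.
Implicit Types v y x : R.

Lemma is_cvg_clifford_series v y : cvgn (pseries (clifford_coef v) y).
Proof.
have [C le_C] := rGamma_bounded (v + 1).
apply: normed_cvg; apply: (@series_le_cvg _ _ (fun k => C * exp_coeff `|y| k)).
- by move=> k; rewrite normr_ge0.
- move=> k; rewrite mulr_ge0 ?exp_coeff_ge0//.
  by apply: le_trans (le_C 0%N); rewrite normr_ge0.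
- move=> k /=; rewrite /clifford_coef !normrM /exp_coeff/= normrX.
  rewrite [`|_^-1|]ger0_norm ?invr_ge0// -mulrA [(_^-1 * _)]mulrC.
  rewrite ler_wpM2r ?mulr_ge0 ?exprn_ge0 ?invr_ge0//.
  by rewrite addrAC; exact: le_C.
- by apply: is_cvg_seriesZ; exact: is_cvg_series_exp_coeff.
Qed.

Lemma clifford_series_cvg v y :
  pseries (clifford_coef v) y @ \oo --> clifford v y.
Proof. by rewrite clifford.unlock; exact: is_cvg_clifford_series. Qed.

Lemma clifford_coef_diffs v :
  pseries_diffs (clifford_coef v) = clifford_coef (v + 1).
Proof.
apply/funext => i; rewrite /pseries_diffs /clifford_coef factS natrM invfM.
have -> : v + i.+1%:R + 1 = v + 1 + i%:R + 1 by rewrite -natr1; ring.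
by rewrite mulrCA; congr (_ * _); rewrite mulVKf// pnatr_eq0.
Qed.

Lemma is_derive_clifford v y :
  is_derive y (1 : R) (clifford v) (clifford (v + 1) y).
Proof.
rewrite clifford.unlock -clifford_coef_diffs.
apply: (@pseries_snd_diffs _ _ (`|y| + 1)); rewrite ?clifford_coef_diffs;
  try exact: is_cvg_clifford_series.
by rewrite [ltRHS]ger0_norm ?ltrDl// addr_ge0.
Qed.

Lemma continuous_clifford v : continuous (clifford v).
Proof. exact: continuous_is_derive (is_derive_clifford v). Qed.

Lemma clifford_rec v y :
  clifford (v - 1) y = v * clifford v y + y * clifford (v + 1) y.
Proof.
pose deriv_series := series (fun i => i%:R * clifford_coef v i * y ^+ i.-1).
have cvg_deriv : deriv_series @ \oo --> clifford (v + 1) y.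
  rewrite clifford.unlock -clifford_coef_diffs; apply: pseries_diffs_equiv.
  by rewrite clifford_coef_diffs; exact: is_cvg_clifford_series.
rewrite {1}clifford.unlock; apply: cvg_lim => //.
have -> : pseries (clifford_coef (v - 1)) y = fun n =>
    v * pseries (clifford_coef v) y n + y * deriv_series n.
  apply/funext => n; rewrite /pseries /deriv_series /series/= !big_distrr.
  rewrite -big_split/=; apply: eq_bigr => i _; rewrite /clifford_coef.
  have -> : v - 1 + i%:R + 1 = v + i%:R by ring.
  rewrite rGamma_rec; case: i => [|i]/=; first by ring.
  by rewrite exprS; ring.
apply: cvgD; apply: cvgM; try exact: cvg_cst; last exact: cvg_deriv.
exact: clifford_series_cvg.
Qed.

Lemma clifford_at0 v : clifford v 0 = rGamma (v + 1).
Proof.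
rewrite clifford.unlock; apply: cvg_lim => //; rewrite -cvg_shiftS.
apply: cvg_near_cst; apply: nearW => n.
rewrite /pseries /series/= big_nat_recl//= big1 ?addr0.
  by rewrite expr0 mulr1 /clifford_coef fact0 invr1 mulr1 addr0.
by move=> i _; rewrite exprS mul0r mulr0.
Qed.

Lemma clifford_coef_ge0 v k : -1 <= v -> 0 <= clifford_coef v k.
Proof.
move=> v1; rewrite mulr_ge0 ?invr_ge0// rGamma_ge0//.
by have := ler0n R k; lra.
Qed.

Lemma clifford_ge_partial_sum v y n : -1 <= v -> 0 <= y ->
  pseries (clifford_coef v) y n <= clifford v y.
Proof.
move=> v1 y0; rewrite clifford.unlock.
apply: nondecreasing_cvgn_le; last exact: is_cvg_clifford_series.
apply/nondecreasing_seqP => m; rewrite /pseries /series/= big_nat_recr//=.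
by rewrite lerDl mulr_ge0 ?clifford_coef_ge0 ?exprn_ge0.
Qed.

Lemma clifford_gt0 v y : -1 <= v -> 0 < y -> 0 < clifford v y.
Proof.
move=> v1 y0; apply: (lt_le_trans _ (clifford_ge_partial_sum 2 v1 (ltW y0))).
rewrite /pseries /series/= big_nat_recr//= big_nat1.
apply: ltr_wpDl.
  by rewrite mulr_ge0 ?clifford_coef_ge0 ?exprn_ge0 ?(ltW y0).
rewrite mulr_gt0 ?exprn_gt0//.
by rewrite divr_gt0// rGamma_gt0//; lra.
Qed.

Lemma besselIE v x : 0 < x ->
  besselI v x = (x / 2) `^ v * clifford v (x ^+ 2 / 4).
Proof.
move=> x0; have x20 : 0 < x / 2 by rewrite divr_gt0.
apply: cvg_lim => //.
rewrite [X in X @ \oo --> _](_ : _ = fun n =>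
    (x / 2) `^ v * pseries (clifford_coef v) (x ^+ 2 / 4) n); last first.
  apply/funext => n; rewrite /pseries /series/= big_distrr/=.
  apply: eq_bigr => k _; rewrite powRD; last first.
    by apply/implyP => _; rewrite gt_eqF.
  rewrite powR_mulrn ?(ltW x20)// -mul2n exprM.
  have -> : (x / 2) ^+ 2 = x ^+ 2 / 4 by field.
  by rewrite /clifford_coef; ring.
by apply: cvgM; [exact: cvg_cst|exact: clifford_series_cvg].
Qed.

End clifford_theory.

Section wronskian_theory.
Context {R : realType}.
Implicit Types v y : R.

Definition wronskian v y : R :=
  clifford v y * extGamma (v + 1) y + y * clifford (v + 1) y * extGamma v y.

Lemma wronskian_pred v y : 0 < y -> wronskian (v - 1) y = wronskian v y.
Proof.
move=> y0; rewrite /wronskian clifford_rec.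
by rewrite (extGamma_rec (extGamma_dom_gt0 v y0)) !subrK; ring.
Qed.

Lemma wronskian_addn v y n : 0 < y -> wronskian (v + n%:R) y = wronskian v y.
Proof.
move=> y0; elim: n => [|n IH]; first by rewrite addr0.
by rewrite -IH -natr1 addrA -wronskian_pred// addrK.
Qed.

Lemma is_derive_wronskian v y : 0 < y -> is_derive y (1 : R) (wronskian v) 0.
Proof.
move=> y0.
have dC0 := is_derive_clifford v y.
have dC1 := is_derive_clifford (v + 1) y.
have dG0 := is_derive_extGamma v y0.
have dG1 := is_derive_extGamma (v + 1) y0; rewrite addrK in dG1.
apply: is_derive_eq (is_deriveD (is_deriveM dC0 dG1)
  (is_deriveM (is_deriveM (is_derive_id y 1) dC1) dG0)) _.
rewrite /GRing.scale/= !fctE/=.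
have := clifford_rec (v + 1) y; rewrite addrK => ->.
rewrite (extGamma_rec (extGamma_dom_gt0 v y0)).
by ring.
Qed.

Lemma wronskian_cst v y z : 0 < y -> 0 < z -> wronskian v y = wronskian v z.
Proof.
wlog yz : y z / y < z.
  move=> eq_lt y0 z0; have [yz|zy|->//] := ltgtP y z; first exact: eq_lt.
  by apply/esym; exact: eq_lt.
move=> y0 z0.
have [c _] : exists2 c, c \in `]y, z[ &
    wronskian v z - wronskian v y = 0 * (z - y).
  apply: (@MVT _ (wronskian v) (fun=> 0)) => //.
    move=> c; rewrite in_itv/= => /andP[yc _].
    by apply: is_derive_wronskian; exact: lt_trans yc.
  apply: derivable_within_continuous => c; rewrite in_itv/= => /andP[yc _].
  by case: (is_derive_wronskian v (lt_le_trans y0 yc)).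
by rewrite mul0r => /eqP; rewrite subr_eq0 => /eqP.
Qed.

Lemma wronskian_cvg_at0 v : 1 < v -> wronskian v y @[y --> 0^'+] --> (1 : R).
Proof.
move=> v1; have v11 : 1 < v + 1 by lra.
have -> : 1 = clifford v 0 * extGamma (v + 1) 0
    + 0 * clifford (v + 1) 0 * extGamma v 0 :> R.
  rewrite mul0r mul0r addr0 clifford_at0 -GammaE ?rGammaE ?mulVf//; try by lra.
  by rewrite gt_eqF// Gamma_gt0; lra.
have cvg_clifford u : clifford u y @[y --> 0^'+] --> clifford u 0.
  by apply: cvg_at_right_filter; exact: continuous_clifford.
apply: cvgD; apply: cvgM; try exact: extGamma_cvg_at0.
  exact: cvg_clifford.
apply: cvgM; last exact: cvg_clifford.
by apply: cvg_at_right_filter; exact: cvg_id.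
Qed.

Lemma wronskianE v y : 0 < y -> wronskian v y = 1.
Proof.
move=> y0; rewrite -(wronskian_addn v (Num.truncn `|v|).+2 y0).
set u := v + _; have u1 : 1 < u.
  rewrite /u -natr1.
  by have := truncnS_gt `|v|; have := ler_norm (- v); rewrite normrN; lra.
rewrite -(cvg_lim _ (wronskian_cvg_at0 u1))//; apply/esym/cvg_lim => //.
apply: cvg_near_cst; near=> z.
have z0 : 0 < z by near: z; exact: nbhs_right_gt.
exact: wronskian_cst.
Unshelve. all: by end_near. Qed.

End wronskian_theory.

(** * Riccati comparison of the ratios *)

Definition ratioI (R : realType) (v x : R) : R :=
  2 * clifford (v - 1) (x ^+ 2 / 4) / clifford v (x ^+ 2 / 4).

Definition ratioK (R : realType) (v x : R) : R :=
  2 * extGamma (v + 1) (x ^+ 2 / 4) / extGamma v (x ^+ 2 / 4).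

(* [ratioI v] and [ratioK v] solve e x h' = x^2 + 2 v h - h^2 for e = 1 and
   e = -1 respectively; [h] and [h'] stand for h x and h' x. *)
Definition riccati_defect (R : realType) (e v x h h' : R) : R :=
  x ^+ 2 + 2 * v * h - h ^+ 2 - e * x * h'.

Section ratio_theory.
Context {R : realType}.
Implicit Types v x : R.

Lemma sqr_div4_gt0 x : 0 < x -> 0 < x ^+ 2 / 4.
Proof. by move=> x0; rewrite divr_gt0// exprn_gt0. Qed.

Lemma clifford_sqr_gt0 v x : 0 < x -> -1 <= v -> 0 < clifford v (x ^+ 2 / 4).
Proof. by move=> x0 v1; rewrite clifford_gt0// sqr_div4_gt0. Qed.

Lemma extGamma_sqr_gt0 v x : 0 < x -> 0 < extGamma v (x ^+ 2 / 4).
Proof. by move=> x0; exact/extGamma_gt0/extGamma_dom_gt0/sqr_div4_gt0. Qed.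

Lemma ratioI_gt0 v x : 0 < x -> 0 <= v -> 0 < ratioI v x.
Proof.
by move=> x0 v0; rewrite divr_gt0 ?mulr_gt0 ?clifford_sqr_gt0//; lra.
Qed.

Lemma ratioK_gt0 v x : 0 < x -> 0 < ratioK v x.
Proof. by move=> x0; rewrite divr_gt0 ?mulr_gt0 ?extGamma_sqr_gt0. Qed.

Lemma ratioI_rec v x : 0 < x -> -1 <= v ->
  ratioI v x = 2 * v + x ^+ 2 / ratioI (v + 1) x.
Proof.
move=> x0 v1; rewrite /ratioI addrK (clifford_rec v).
have := clifford_sqr_gt0 x0 v1.
have : 0 < clifford (v + 1) (x ^+ 2 / 4) by rewrite clifford_sqr_gt0//; lra.
move: (clifford v _) (clifford (v + 1) _) => a b b0 a0.
by field; rewrite !gt_eqF.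
Qed.

Lemma ratioK_rec v x : 0 < x -> ratioK v x = 2 * v + x ^+ 2 / ratioK (v - 1) x.
Proof.
move=> x0; rewrite /ratioK subrK extGamma_rec; last first.
  exact/extGamma_dom_gt0/sqr_div4_gt0.
have := extGamma_sqr_gt0 v x0; have := extGamma_sqr_gt0 (v - 1) x0.
move: (extGamma v _) (extGamma (v - 1) _) => a b b0 a0.
by field; rewrite !gt_eqF.
Qed.

Lemma besselIK_inv_ratioK v x : 0 < x -> -1 <= v ->
  (besselI v x * besselK v x)^-1 = ratioK v x + x ^+ 2 / ratioI (v + 1) x.
Proof.
move=> x0 v1; rewrite besselIE// besselKE//.
have powR_cancel : (x / 2) `^ v * (2 / x) `^ v = 1.
  rewrite -powRM ?divr_ge0 ?(ltW x0)// mulrC -[2 / x]invf_div mulVf ?powR1//.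
  by rewrite gt_eqF ?divr_gt0.
have -> : (x / 2) `^ v * clifford v (x ^+ 2 / 4) *
    ((2 / x) `^ v * extGamma v (x ^+ 2 / 4) / 2) =
    clifford v (x ^+ 2 / 4) * extGamma v (x ^+ 2 / 4) / 2.
  by rewrite mulrA mulrACA powR_cancel mul1r.
have := wronskianE v (sqr_div4_gt0 x0); rewrite /wronskian.
have := extGamma_sqr_gt0 v x0; have := clifford_sqr_gt0 x0 v1.
have : 0 < clifford (v + 1) (x ^+ 2 / 4) by rewrite clifford_sqr_gt0//; lra.
rewrite /ratioK /ratioI addrK.
move: (clifford v _) (clifford (v + 1) _) (extGamma v _) (extGamma (v + 1) _).
move=> a b g k b0 a0 g0 wronsk1.
transitivity (2 * (a * k + x ^+ 2 / 4 * b * g) / (a * g)).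
  by rewrite wronsk1 mulr1; field; rewrite !gt_eqF.
by field; rewrite !gt_eqF.
Qed.

Lemma besselIK_inv_ratioI v x : 0 < x -> -1 <= v ->
  (besselI v x * besselK v x)^-1 = ratioI v x + x ^+ 2 / ratioK (v - 1) x.
Proof.
move=> x0 v1; rewrite besselIK_inv_ratioK// (ratioI_rec x0 v1) (ratioK_rec v)//.
by ring.
Qed.

Lemma besselIK_inv_sum v x : 0 < x -> -1 <= v ->
  (besselI v x * besselK v x)^-1 = ratioI v x + ratioK v x - 2 * v.
Proof.
by move=> x0 v1; rewrite besselIK_inv_ratioK// (ratioI_rec x0 v1); ring.
Qed.

Lemma besselIK_gt0 v x : 0 < x -> -1 <= v -> 0 < besselI v x * besselK v x.
Proof.
move=> x0 v1; rewrite -invr_gt0 besselIK_inv_ratioK// addr_gt0 ?ratioK_gt0//.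
by rewrite divr_gt0 ?exprn_gt0// ratioI_gt0//; lra.
Qed.

End ratio_theory.

Section riccati_comparison.
Context {R : realType}.
Implicit Types (e v c x : R) (a b h : R -> R).

Lemma is_derive_sqr_div4 x : is_derive x (1 : R) (fun t => t ^+ 2 / 4) (x / 2).
Proof.
have -> : (fun t : R => t ^+ 2 / 4) = 4^-1 \*: (id * id).
  by apply/funext => t; rewrite !fctE/= /GRing.scale/= mulrC.
by apply: is_derive_eq; rewrite /GRing.scale/=; field.
Qed.

Lemma is_derive_comp_sqr_div4 (F : R -> R) x l :
  is_derive (x ^+ 2 / 4) (1 : R) F l ->
  is_derive x (1 : R) (fun t => F (t ^+ 2 / 4)) (l * (x / 2)).
Proof.
move=> dF; exact: (@is_derive1_comp _ F (fun t => t ^+ 2 / 4) x l _ dF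
  (is_derive_sqr_div4 x)).
Qed.

Lemma continuous_comp_sqr_div4 (F : R -> R) :
  continuous F -> continuous (fun t : R => F (t ^+ 2 / 4)).
Proof.
move=> cF x; apply: (@continuous_comp R R R (fun t => t ^+ 2 / 4) F).
  exact: continuous_is_derive is_derive_sqr_div4 x.
exact: cF.
Qed.

(* a = 2 C_(v-1), b = C_v for e = 1 and a = 2 G_(v+1), b = G_v for e = -1. *)
Lemma is_derive_riccati_gap e v c a b h x (h' : R) : e ^+ 2 = 1 -> x != 0 ->
  is_derive x (1 : R) h h' -> is_derive x (1 : R) a (e * x * b x) ->
  is_derive x (1 : R) b (e * (a x - 2 * v * b x) / x) ->
  is_derive x (1 : R) (fun t => c * (a t - h t * b t))
    (e * (c * b x * riccati_defect e v x (h x) h'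
          - h x * (c * (a x - h x * b x))) / x).
Proof.
move=> e2 x0 dh da db.
have -> : (fun t => c * (a t - h t * b t)) = c \*: (a - h * b) by [].
apply: is_derive_eq; rewrite /riccati_defect /GRing.scale/=.
transitivity (c * (e * x * b x - h x * (e * (a x - 2 * v * b x) / x)
  - e ^+ 2 * h' * b x)); first by rewrite e2; ring.
by field.
Qed.

Section ratioI_comparison.
Variables (v c : R) (h h' : R -> R).
Hypothesis v_ge : -1 <= v.
Hypothesis ch : continuous h.
Hypothesis dh : forall x, 0 < x -> is_derive x (1 : R) h (h' x).
Hypothesis h_gt0 : forall x, 0 < x -> 0 < h x.

Let a x := 2 * clifford (v - 1) (x ^+ 2 / 4).
Let b x := clifford v (x ^+ 2 / 4).
Let gap x := c * (a x - h x * b x).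

Let is_derive_gap x : 0 < x -> is_derive x (1 : R) gap
  ((c * b x * riccati_defect 1 v x (h x) (h' x) - h x * gap x) / x).
Proof.
move=> x0; have dhx := dh x0.
have dC u := is_derive_comp_sqr_div4 (is_derive_clifford u (x ^+ 2 / 4)).
have da : is_derive x (1 : R) a (1 * x * b x).
  apply: is_derive_eq (is_deriveZ 2 (dC (v - 1))) _.
  by rewrite subrK /GRing.scale/= /b; field.
have db : is_derive x (1 : R) b (1 * (a x - 2 * v * b x) / x).
  apply: is_derive_eq (dC v) _; rewrite /a /b clifford_rec.
  by field; rewrite gt_eqF.
rewrite -[X in X / x]mul1r.
by apply: is_derive_riccati_gap; rewrite ?expr1n ?gt_eqF.
Qed.

Let continuous_gap : continuous gap.
Proof.
have cC u : continuous (fun x => clifford u (x ^+ 2 / 4)).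
  by apply: continuous_comp_sqr_div4; exact: continuous_clifford.
move=> x; apply: cvgM; first exact: cvg_cst.
apply: cvgB; first by apply: cvgM; [exact: cvg_cst|exact: cC].
by apply: cvgM; [exact: ch|exact: cC].
Qed.

Let gap0 : gap 0 = c * (2 * v - h 0) * rGamma (v + 1).
Proof.
rewrite /gap /a /b expr0n/= mul0r clifford_rec mul0r addr0 clifford_at0.
by ring.
Qed.

Let ratioI_gap x : 0 < x -> 0 < gap x -> 0 < c * (ratioI v x - h x).
Proof.
move=> x0 gap_gt0; have b0 := clifford_sqr_gt0 x0 v_ge.
have -> : c * (ratioI v x - h x) = gap x / b x.
  by rewrite /gap /ratioI /a /b; field; rewrite gt_eqF.
by rewrite divr_gt0.
Qed.

Lemma ratioI_comparison : 0 <= c * (2 * v - h 0) ->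
  (forall x, 0 < x -> 0 < c * riccati_defect 1 v x (h x) (h' x)) ->
  forall x, 0 < x -> 0 < c * (ratioI v x - h x).
Proof.
move=> h0 defect_gt0 x x0; apply: ratioI_gap => //.
apply: (gt0_of_initial_ge0 is_derive_gap continuous_gap _ _ x0).
  by rewrite gap0 mulr_ge0// rGamma_ge0//; have := v_ge; lra.
move=> y y0 gap_le0; rewrite divr_gt0// ltr_wpDr//.
  by rewrite -mulrN mulr_ge0 ?oppr_ge0// ltW// h_gt0.
by rewrite mulrAC mulr_gt0 ?defect_gt0// clifford_sqr_gt0.
Qed.

Lemma ratioI_comparison_initial_gt0 : -1 < v -> 0 < c * (2 * v - h 0) ->
  (forall x, 0 < x -> 0 <= c * riccati_defect 1 v x (h x) (h' x)) ->
  forall x, 0 < x -> 0 < c * (ratioI v x - h x).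
Proof.
move=> v1 h0 defect_ge0 x x0; apply: ratioI_gap => //.
apply: (gt0_of_initial_gt0 is_derive_gap continuous_gap
  (p := fun y => h y / y) _ _ _ _ x0).
- by rewrite gap0 mulr_gt0// rGamma_gt0//; lra.
- by move=> y y0; rewrite divr_gt0 ?h_gt0.
- move=> y y0; apply: cvgM; first exact: ch.
  by apply: cvgV; [rewrite gt_eqF|exact: cvg_id].
- move=> y y0; rewrite mulrAC -mulNr ler_pM2r ?invr_gt0// lerDr mulrAC.
  by rewrite mulr_ge0 ?defect_ge0// ltW// clifford_sqr_gt0.
Qed.

End ratioI_comparison.

Section ratioK_comparison.
Variables (v c C : R) (h h' : R -> R).
Hypothesis dh : forall x, 0 < x -> is_derive x (1 : R) h (h' x).
Hypothesis h_gt0 : forall x, 0 < x -> 0 < h x.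
Hypothesis h_le : forall x, 1 <= x -> h x <= C * x ^+ 2.

Let a x := 2 * extGamma (v + 1) (x ^+ 2 / 4).
Let b x := extGamma v (x ^+ 2 / 4).
Let gap x := c * (a x - h x * b x).

Let is_derive_gap x : 0 < x -> is_derive x (1 : R) gap
  (-1 * (c * b x * riccati_defect (-1) v x (h x) (h' x) - h x * gap x) / x).
Proof.
move=> x0; have dhx := dh x0; have q0 := sqr_div4_gt0 x0.
have dG p := is_derive_comp_sqr_div4 (is_derive_extGamma p q0).
have da : is_derive x (1 : R) a (-1 * x * b x).
  apply: is_derive_eq (is_deriveZ 2 (dG (v + 1))) _.
  by rewrite addrK /GRing.scale/= /b; field.
have db : is_derive x (1 : R) b (-1 * (a x - 2 * v * b x) / x).
  apply: is_derive_eq (dG v) _; rewrite /a /b extGamma_rec.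
    by field; rewrite gt_eqF.
  exact: extGamma_dom_gt0.
by apply: is_derive_riccati_gap; rewrite ?sqrrN ?expr1n ?gt_eqF.
Qed.

Let gap_cvgy : gap x @[x --> +oo] --> 0.
Proof.
have sqr_cvgy : (x : R) ^+ 2 / 4 @[x --> +oo] --> +oo.
  by apply: gt0_cvgMly; [rewrite invr_gt0|exact: cvgr_expr2].
have a_cvg : a x @[x --> +oo] --> 0.
  rewrite -(mulr0 2); apply: cvgM; first exact: cvg_cst.
  exact: cvg_comp sqr_cvgy (extGamma_cvgy (v + 1)).
have hb_cvg : h x * b x @[x --> +oo] --> 0.
  apply: (@squeeze_cvgr _ _ _ _ (cst 0)
    (fun x => 4 * C * (x ^+ 2 / 4 * extGamma v (x ^+ 2 / 4)))).
  - near=> x.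
    have x1 : 1 <= x by near: x; apply: nbhs_pinfty_ge; exact: num_real.
    have x0 : 0 < x by exact: lt_le_trans x1.
    have b0 := extGamma_sqr_gt0 v x0.
    rewrite mulr_ge0 ?(ltW (h_gt0 x0)) ?(ltW b0)//=.
    rewrite (_ : _ * (_ * _) = C * x ^+ 2 * b x); last by rewrite /b; field.
    by rewrite ler_wpM2r ?(ltW b0)// h_le.
  - exact: cvg_cst.
  - rewrite -(mulr0 (4 * C)); apply: cvgM; first exact: cvg_cst.
    exact: cvg_comp sqr_cvgy (mulr_extGamma_cvgy v).
rewrite -(mulr0 c) -[X in c * X](subr0 0); apply: cvgM; first exact: cvg_cst.
exact: cvgB.
Unshelve. all: by end_near. Qed.

Lemma ratioK_comparison :
  (forall x, 0 < x -> 0 <= c * riccati_defect (-1) v x (h x) (h' x)) ->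
  forall x, 0 < x -> 0 <= c * (ratioK v x - h x).
Proof.
move=> defect_ge0 x x0; have b_gt0 y (y0 : 0 < y) := extGamma_sqr_gt0 v y0.
have -> : c * (ratioK v x - h x) = gap x / b x.
  by rewrite /gap /ratioK /a /b; field; rewrite gt_eqF// b_gt0.
rewrite divr_ge0 ?(ltW (b_gt0 _ x0))//.
apply: (ge0_of_cvgy0 is_derive_gap gap_cvgy _ x0) => y y0 gap_lt0.
rewrite mulN1r pmulr_llt0 ?invr_gt0// oppr_lt0 ltr_pwDr//.
  by rewrite -mulrN mulr_gt0 ?h_gt0 ?oppr_gt0.
by rewrite mulrAC mulr_ge0 ?defect_ge0// ltW// b_gt0.
Qed.

End ratioK_comparison.

End riccati_comparison.

(** * Bounds on the ratios *)

(* For z = x^2 and s = sqrt (D + g z), this is s times the Riccati defect of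
   al + s. *)
Definition riccati_sqrt_numerator (R : realType) (e v al g z s : R) : R :=
  s * (z + 2 * v * (al + s) - (al + s) ^+ 2) - e * g * z.

Section sqrt_comparison.
Context {R : realType}.
Variables v c al D g : R.
Hypothesis D_ge0 : 0 <= D.
Hypothesis g_gt0 : 0 < g.
Hypothesis al_ge : 0 <= al + Num.sqrt D.
Implicit Types x z : R.

Let s x : R := Num.sqrt (D + g * x ^+ 2).
Let h x : R := al + s x.

Let radicand_gt x : 0 < x -> D < D + g * x ^+ 2.
Proof. by move=> x0; rewrite ltrDl mulr_gt0 ?exprn_gt0. Qed.

Let s_gt x : 0 < x -> Num.sqrt D < s x.
Proof.
by move=> x0; rewrite ltr_sqrt ?radicand_gt// (le_lt_trans D_ge0) ?radicand_gt.
Qed.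

Let s_gt0 x : 0 < x -> 0 < s x.
Proof. by move=> /s_gt; apply: le_lt_trans; exact: sqrtr_ge0. Qed.

Let sqr_s x : s x ^+ 2 = D + g * x ^+ 2.
Proof. by rewrite sqr_sqrtr// addr_ge0// mulr_ge0 ?sqr_ge0 ?(ltW g_gt0). Qed.

Let h_gt0 x : 0 < x -> 0 < h x.
Proof. by move=> /s_gt sx; rewrite (le_lt_trans al_ge)// ltrD2l. Qed.

Let h0 : h 0 = al + Num.sqrt D.
Proof. by rewrite /h /s expr0n/= mulr0 addr0. Qed.

Let is_derive_radicand x :
  is_derive x (1 : R) (fun t => D + g * t ^+ 2) (2 * g * x).
Proof.
have -> : (fun t => D + g * t ^+ 2) = cst D + g \*: (id * id) by [].
by apply: is_derive_eq; rewrite /GRing.scale/=; ring.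
Qed.

Let continuous_h : continuous h.
Proof.
move=> x; apply: cvgD; first exact: cvg_cst.
apply: (@continuous_comp R R R (fun t => D + g * t ^+ 2) Num.sqrt).
  exact: continuous_is_derive is_derive_radicand x.
exact: sqrt_continuous.
Qed.

Let is_derive_h x : 0 < x -> is_derive x (1 : R) h (g * x / s x).
Proof.
move=> x0; have rad0 := le_lt_trans D_ge0 (radicand_gt x0).
have ds := @is_derive1_comp _ Num.sqrt (fun t => D + g * t ^+ 2) x _ _
  (is_derive1_sqrt rad0) (is_derive_radicand x).
apply: is_derive_eq (is_deriveD (is_derive_cst al x 1) ds) _.
by rewrite add0r -/(s x); field; rewrite gt_eqF ?s_gt0.
Qed.

Let h_le x : 1 <= x -> h x <= (`|al| + D + g + 1) * x ^+ 2.
Proof.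
move=> x1; have x2 : 1 <= x ^+ 2 by rewrite exprn_ege1.
have sx := s_gt0 (lt_le_trans ltr01 x1); have sq := sqr_s x.
have sx_le : s x <= D + g * x ^+ 2 + 1 by nra.
have := ler_norm al; have := normr_ge0 al; have := D_ge0.
by rewrite /h; nra.
Qed.

Let defectE e x : 0 < x -> riccati_defect e v x (h x) (g * x / s x) =
  riccati_sqrt_numerator e v al g (x ^+ 2) (s x) / s x.
Proof.
move=> x0; rewrite /riccati_defect /riccati_sqrt_numerator /h.
by field; rewrite gt_eqF ?s_gt0.
Qed.

Lemma ratioI_sqrt_comparison : -1 <= v ->
  0 <= c * (2 * v - (al + Num.sqrt D)) ->
  (forall z t, 0 < z -> Num.sqrt D < t -> t ^+ 2 = D + g * z ->
    0 < c * riccati_sqrt_numerator 1 v al g z t) ->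
  forall x, 0 < x -> 0 < c * (ratioI v x - (al + Num.sqrt (D + g * x ^+ 2))).
Proof.
move=> v1; rewrite -h0 => c_h0 num_gt0.
apply: (ratioI_comparison v1 continuous_h is_derive_h h_gt0 c_h0) => x x0.
by rewrite defectE// mulrA divr_gt0 ?s_gt0// num_gt0 ?exprn_gt0 ?s_gt.
Qed.

Lemma ratioI_sqrt_comparison_initial_gt0 : -1 < v ->
  0 < c * (2 * v - (al + Num.sqrt D)) ->
  (forall z t, 0 < z -> Num.sqrt D < t -> t ^+ 2 = D + g * z ->
    0 <= c * riccati_sqrt_numerator 1 v al g z t) ->
  forall x, 0 < x -> 0 < c * (ratioI v x - (al + Num.sqrt (D + g * x ^+ 2))).
Proof.
move=> v1; rewrite -h0 => c_h0 num_ge0.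
apply: (ratioI_comparison_initial_gt0 (ltW v1) continuous_h is_derive_h h_gt0
  v1 c_h0) => x x0.
rewrite defectE// mulrA divr_ge0 ?(ltW (s_gt0 x0))//.
by rewrite num_ge0 ?exprn_gt0 ?s_gt.
Qed.

Lemma ratioK_sqrt_comparison :
  (forall z t, 0 < z -> Num.sqrt D < t -> t ^+ 2 = D + g * z ->
    0 <= c * riccati_sqrt_numerator (-1) v al g z t) ->
  forall x, 0 < x -> 0 <= c * (ratioK v x - (al + Num.sqrt (D + g * x ^+ 2))).
Proof.
move=> num_ge0; apply: (ratioK_comparison is_derive_h h_gt0 h_le) => x x0.
rewrite defectE// mulrA divr_ge0 ?(ltW (s_gt0 x0))//.
by rewrite num_ge0 ?exprn_gt0 ?s_gt.
Qed.

End sqrt_comparison.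

Section riccati_sqrt_numerators.
Context {R : realType}.
Implicit Types e v al z s : R.

Lemma riccati_sqrt_numerator_same e v z s : s ^+ 2 = v ^+ 2 + 1 * z ->
  riccati_sqrt_numerator e v v 1 z s = - (e * z).
Proof.
rewrite mul1r => s2; have -> : z = s ^+ 2 - v ^+ 2 by rewrite s2; ring.
by rewrite /riccati_sqrt_numerator; ring.
Qed.

Lemma riccati_sqrt_numerator_half e v al z s : al = v - e / 2 ->
  s ^+ 2 = al ^+ 2 + 1 * z ->
  riccati_sqrt_numerator e v al 1 z s = e * (al * (al + s)).
Proof.
move=> alE; rewrite mul1r => s2.
have -> : z = s ^+ 2 - al ^+ 2 by rewrite s2; ring.
by rewrite /riccati_sqrt_numerator alE; field.
Qed.

Lemma riccati_sqrt_numerator_weighted e v z s : v + e != 0 ->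
  s ^+ 2 = v ^+ 2 + v / (v + e) * z ->
  riccati_sqrt_numerator e v v (v / (v + e)) z s = e * (z * (s - v) / (v + e)).
Proof.
move=> ve0 s2; rewrite /riccati_sqrt_numerator.
have -> : z + 2 * v * (v + s) - (v + s) ^+ 2 = z + v ^+ 2 - s ^+ 2 by ring.
by rewrite s2; field.
Qed.

Lemma riccati_sqrt_numerator_quarter e v al z s :
  e ^+ 2 = 1 -> al = v - e / 2 ->
  s ^+ 2 = v ^+ 2 - 1 / 4 + 1 * z ->
  riccati_sqrt_numerator e v al 1 z s = e * (v ^+ 2 - 1 / 4).
Proof.
move=> e2 alE; rewrite [1 * z]mul1r => s2.
have -> : v ^+ 2 - 1 / 4 = s ^+ 2 - z by rewrite s2; ring.
rewrite /riccati_sqrt_numerator.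
have -> : z + 2 * v * (al + s) - (al + s) ^+ 2 = e * s.
  have -> : z = s ^+ 2 - (v ^+ 2 - e ^+ 2 / 4) by rewrite e2 s2; ring.
  by rewrite alE; field.
by ring.
Qed.

End riccati_sqrt_numerators.

Section ratio_bounds.
Context {R : realType}.
Implicit Types v x a : R.

Lemma addr_sqrtr_sqr_ge0 a : 0 <= a + Num.sqrt (a ^+ 2).
Proof. by rewrite sqrtr_sqr; have := ler_norm (- a); rewrite normrN; lra. Qed.

Lemma ratioI_lt_sqrt v x : 0 < x -> 0 <= v ->
  ratioI v x < v + Num.sqrt (v ^+ 2 + x ^+ 2).
Proof.
move=> x0 v0; rewrite -[x ^+ 2]mul1r.
suff : 0 < -1 * (ratioI v x - (v + Num.sqrt (v ^+ 2 + 1 * x ^+ 2))) by lra.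
apply: ratioI_sqrt_comparison x0;
  rewrite ?sqr_ge0 ?addr_sqrtr_sqr_ge0//; first by lra.
  by rewrite sqrtr_sqr ger0_norm//; lra.
move=> z s z0 _ s2; by rewrite riccati_sqrt_numerator_same//; lra.
Qed.

Lemma ratioK_ge_sqrt v x : 0 < x ->
  v + Num.sqrt (v ^+ 2 + x ^+ 2) <= ratioK v x.
Proof.
move=> x0; rewrite -[x ^+ 2]mul1r.
suff : 0 <= 1 * (ratioK v x - (v + Num.sqrt (v ^+ 2 + 1 * x ^+ 2))) by lra.
apply: ratioK_sqrt_comparison x0; rewrite ?sqr_ge0 ?addr_sqrtr_sqr_ge0//.
move=> z s z0 _ s2; by rewrite riccati_sqrt_numerator_same//; lra.
Qed.

Lemma ratioI_gt_sqrt_half v x : 0 < x -> 1 / 2 <= v ->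
  v - 1 / 2 + Num.sqrt ((v - 1 / 2) ^+ 2 + x ^+ 2) < ratioI v x.
Proof.
move=> x0 v0; rewrite -[x ^+ 2]mul1r; set al := v - 1 / 2.
have al_ge0 : 0 <= al by rewrite subr_ge0.
have sqrt_al : Num.sqrt (al ^+ 2) = al by rewrite sqrtr_sqr ger0_norm.
suff : 0 < 1 * (ratioI v x - (al + Num.sqrt (al ^+ 2 + 1 * x ^+ 2))) by lra.
apply: ratioI_sqrt_comparison_initial_gt0 x0;
  rewrite ?sqr_ge0 ?sqrt_al//; try by rewrite /al; lra.
move=> z s z0 al_lt s2.
by rewrite (riccati_sqrt_numerator_half _ s2)// !mul1r mulr_ge0//; lra.
Qed.

Lemma ratioK_le_sqrt_half v x : 0 < x -> - (1 / 2) <= v ->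
  ratioK v x <= v + 1 / 2 + Num.sqrt ((v + 1 / 2) ^+ 2 + x ^+ 2).
Proof.
move=> x0 v0; rewrite -[x ^+ 2]mul1r; set al := v + 1 / 2.
have al_ge0 : 0 <= al by rewrite /al; lra.
have sqrt_al : Num.sqrt (al ^+ 2) = al by rewrite sqrtr_sqr ger0_norm.
suff : 0 <= -1 * (ratioK v x - (al + Num.sqrt (al ^+ 2 + 1 * x ^+ 2))) by lra.
apply: ratioK_sqrt_comparison x0; rewrite ?sqr_ge0 ?sqrt_al//; first by lra.
move=> z s z0 al_lt s2.
rewrite (riccati_sqrt_numerator_half _ s2); last by rewrite mulNr opprK.
by rewrite !mulN1r opprK mulr_ge0//; lra.
Qed.

Lemma ratioI_gt_sqrt_weighted v x : 0 < x -> 0 < v ->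
  v + Num.sqrt (v ^+ 2 + v / (v + 1) * x ^+ 2) < ratioI v x.
Proof.
move=> x0 v0; have v1 : 0 < v + 1 by lra.
have sqrt_v : Num.sqrt (v ^+ 2) = v by rewrite sqrtr_sqr gtr0_norm.
suff : 0 < 1 * (ratioI v x -
  (v + Num.sqrt (v ^+ 2 + v / (v + 1) * x ^+ 2))) by lra.
apply: ratioI_sqrt_comparison x0;
  rewrite ?sqr_ge0 ?sqrt_v ?divr_gt0//; try by lra.
move=> z s z0 v_lt s2.
rewrite riccati_sqrt_numerator_weighted ?gt_eqF// !mul1r.
by rewrite divr_gt0// mulr_gt0// subr_gt0.
Qed.

Lemma ratioK_le_sqrt_weighted v x : 0 < x -> 1 < v ->
  ratioK v x <= v + Num.sqrt (v ^+ 2 + v / (v - 1) * x ^+ 2).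
Proof.
move=> x0 v1; have v0 : 0 < v by lra.
have v10 : 0 < v - 1 by lra.
have sqrt_v : Num.sqrt (v ^+ 2) = v by rewrite sqrtr_sqr gtr0_norm.
suff : 0 <= -1 * (ratioK v x -
  (v + Num.sqrt (v ^+ 2 + v / (v - 1) * x ^+ 2))) by lra.
apply: ratioK_sqrt_comparison x0;
  rewrite ?sqr_ge0 ?sqrt_v ?divr_gt0//; first by lra.
move=> z s z0 v_lt s2.
rewrite riccati_sqrt_numerator_weighted ?gt_eqF// !mulN1r opprK.
by rewrite divr_ge0 ?mulr_ge0 ?subr_ge0 ?ltW.
Qed.

Lemma ratioI_gt_sqrt_quarter v x : 0 < x -> 1 / 2 < v ->
  v - 1 / 2 + Num.sqrt (v ^+ 2 - 1 / 4 + x ^+ 2) < ratioI v x.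
Proof.
move=> x0 v0; rewrite -[x ^+ 2]mul1r; set D := v ^+ 2 - 1 / 4.
have D0 : 0 < D by rewrite /D; nra.
have sqrtD_ge0 := sqrtr_ge0 D.
have sqrtD_le : Num.sqrt D <= v.
  rewrite -[leRHS]gtr0_norm; last by lra.
  by rewrite -sqrtr_sqr ler_wsqrtr// /D; lra.
suff : 0 < 1 * (ratioI v x - (v - 1 / 2 + Num.sqrt (D + 1 * x ^+ 2))) by lra.
apply: ratioI_sqrt_comparison x0; rewrite ?(ltW D0)//; try by lra.
move=> z s z0 _ s2.
by rewrite (riccati_sqrt_numerator_quarter _ _ s2) ?expr1n// 2!mul1r.
Qed.

Lemma ratioK_le_sqrt_quarter v x : 0 < x -> 1 / 2 <= v ->
  ratioK v x <= v + 1 / 2 + Num.sqrt (v ^+ 2 - 1 / 4 + x ^+ 2).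
Proof.
move=> x0 v0; rewrite -[x ^+ 2]mul1r; set D := v ^+ 2 - 1 / 4.
have D0 : 0 <= D by rewrite /D; nra.
have sqrtD_ge0 := sqrtr_ge0 D.
suff : 0 <= -1 * (ratioK v x - (v + 1 / 2 + Num.sqrt (D + 1 * x ^+ 2))) by lra.
apply: ratioK_sqrt_comparison x0 => //; first by lra.
move=> z s z0 _ s2.
rewrite (riccati_sqrt_numerator_quarter _ _ s2) ?sqrrN ?expr1n//.
  by rewrite !mulN1r opprK.
by rewrite mulNr opprK.
Qed.

End ratio_bounds.

Section ratio_recurrence_bounds.
Context {R : realType}.
Implicit Types (v w m x a c B : R).

Lemma normr_lt_sqrtr_sqrD a c : 0 < c -> `|a| < Num.sqrt (a ^+ 2 + c).
Proof.
by move=> c0; rewrite -sqrtr_sqr ltr_sqrt ?ltrDl// ltr_wpDl ?sqr_ge0.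
Qed.

Lemma addr_sqrtr_sqrD_gt0 a c : 0 < c -> 0 < a + Num.sqrt (a ^+ 2 + c).
Proof.
move=> /(normr_lt_sqrtr_sqrD a).
by have := ler_norm (- a); rewrite normrN; lra.
Qed.

Lemma divr_addr_sqrtr a c : 0 < c ->
  c / (a + Num.sqrt (a ^+ 2 + c)) = Num.sqrt (a ^+ 2 + c) - a.
Proof.
move=> c0; have as_gt0 := addr_sqrtr_sqrD_gt0 a c0.
apply: (mulIf (lt0r_neq0 as_gt0)); rewrite divfK ?gt_eqF// [a + _]addrC.
rewrite -subr_sqr sqr_sqrtr ?addr_ge0 ?sqr_ge0 ?ltW//.
by rewrite addrAC subrr add0r.
Qed.

Lemma divr_addr_sqrtr_weighted w m x : 0 < x -> 0 < w -> 0 < m ->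
  x ^+ 2 / (w + Num.sqrt (w ^+ 2 + w / m * x ^+ 2)) =
  Num.sqrt (m ^+ 2 + m / w * x ^+ 2) - m.
Proof.
move=> x0 w0 m0.
have -> : m ^+ 2 + m / w * x ^+ 2 = (m / w) ^+ 2 * (w ^+ 2 + w / m * x ^+ 2).
  by field; rewrite !gt_eqF.
rewrite sqrtrM ?sqr_ge0// sqrtr_sqr gtr0_norm ?divr_gt0//.
have c0 : 0 < w / m * x ^+ 2 by rewrite mulr_gt0 ?divr_gt0 ?exprn_gt0.
rewrite {1}(_ : x ^+ 2 = m / w * (w / m * x ^+ 2)); last first.
  by field; rewrite !gt_eqF.
by rewrite -mulrA divr_addr_sqrtr// mulrBr [m / w * w]divfK ?gt_eqF.
Qed.

Lemma ltr_pdiv2l c a B : 0 < c -> 0 < a -> a < B -> c / B < c / a.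
Proof.
by move=> c0 a0 aB; rewrite ltr_pM2l// ltf_pV2 ?posrE//; exact: lt_trans aB.
Qed.

Lemma ler_pdiv2l c a B : 0 < c -> 0 < a -> a <= B -> c / B <= c / a.
Proof.
by move=> c0 a0 aB; rewrite ler_pM2l// lef_pV2 ?posrE//; exact: lt_le_trans aB.
Qed.

Lemma ratioI_gt_of_succ v x B : 0 < x -> -1 <= v -> ratioI (v + 1) x < B ->
  2 * v + x ^+ 2 / B < ratioI v x.
Proof.
move=> x0 v1 ltB; rewrite (ratioI_rec x0 v1) ltrD2l ltr_pdiv2l ?exprn_gt0//.
by rewrite ratioI_gt0//; lra.
Qed.

Lemma ratioI_lt_of_succ v x B : 0 < x -> -1 <= v -> 0 < B ->
  B < ratioI (v + 1) x -> ratioI v x < 2 * v + x ^+ 2 / B.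
Proof.
by move=> x0 v1 B0 ltB; rewrite (ratioI_rec x0 v1) ltrD2l ltr_pdiv2l ?exprn_gt0.
Qed.

Lemma ratioK_ge_of_pred v x B : 0 < x -> ratioK (v - 1) x <= B ->
  2 * v + x ^+ 2 / B <= ratioK v x.
Proof.
move=> x0 leB; rewrite (ratioK_rec v x0) lerD2l ler_pdiv2l ?exprn_gt0//.
exact: ratioK_gt0.
Qed.

Lemma ratioK_le_of_pred v x B : 0 < x -> 0 < B -> B <= ratioK (v - 1) x ->
  ratioK v x <= 2 * v + x ^+ 2 / B.
Proof.
by move=> x0 B0 leB; rewrite (ratioK_rec v x0) lerD2l ler_pdiv2l ?exprn_gt0.
Qed.

Lemma ratioK_le_of_succ v x B : 0 < x -> 0 < B ->
  2 * (v + 1) + B <= ratioK (v + 1) x -> ratioK v x <= x ^+ 2 / B.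
Proof.
move=> x0 B0; rewrite (ratioK_rec (v + 1) x0) lerD2l addrK.
by rewrite !ler_pdivlMr ?ratioK_gt0// mulrC.
Qed.

Lemma ratioK_le_sqrt_succ v x : 0 < x ->
  ratioK v x <= v + 1 + Num.sqrt ((v + 1) ^+ 2 + x ^+ 2).
Proof.
move=> x0; have x2 : 0 < x ^+ 2 by rewrite exprn_gt0.
have := divr_addr_sqrtr (- (v + 1)) x2; rewrite sqrrN opprK [in RHS]addrC => <-.
apply: ratioK_le_of_succ => //.
  by have := addr_sqrtr_sqrD_gt0 (- (v + 1)) x2; rewrite sqrrN.
by apply: le_trans (ratioK_ge_sqrt (v + 1) x0); lra.
Qed.

Lemma ratioK_le_sqrt_pred v x : 0 < x ->
  ratioK v x <= v + 1 + Num.sqrt ((v - 1) ^+ 2 + x ^+ 2).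
Proof.
move=> x0; have x2 : 0 < x ^+ 2 by rewrite exprn_gt0.
have := ratioK_le_of_pred x0 (addr_sqrtr_sqrD_gt0 (v - 1) x2)
  (ratioK_ge_sqrt (v - 1) x0).
by rewrite divr_addr_sqrtr//; lra.
Qed.

Lemma ratioI_gt_sqrt_succ v x : 0 < x -> -1 <= v ->
  v - 1 + Num.sqrt ((v + 1) ^+ 2 + x ^+ 2) < ratioI v x.
Proof.
move=> x0 v1; have v10 : 0 <= v + 1 by lra.
have := ratioI_gt_of_succ x0 v1 (ratioI_lt_sqrt x0 v10).
by rewrite divr_addr_sqrtr ?exprn_gt0//; lra.
Qed.

Lemma ratioK_ge_sqrt_half v x : 0 < x -> 1 / 2 <= v ->
  v + 1 / 2 + Num.sqrt ((v - 1 / 2) ^+ 2 + x ^+ 2) <= ratioK v x.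
Proof.
move=> x0 v0; have v1 : - (1 / 2) <= v - 1 by lra.
have := ratioK_ge_of_pred x0 (ratioK_le_sqrt_half x0 v1).
have -> : v - 1 + 1 / 2 = v - 1 / 2 by field.
by rewrite divr_addr_sqrtr ?exprn_gt0//; lra.
Qed.

Lemma ratioI_lt_sqrt_half v x : 0 < x -> - (1 / 2) <= v ->
  ratioI v x < v - 1 / 2 + Num.sqrt ((v + 1 / 2) ^+ 2 + x ^+ 2).
Proof.
move=> x0 v0; have v1 : 1 / 2 <= v + 1 by lra.
have v_ge : -1 <= v by lra.
have x2 : 0 < x ^+ 2 by rewrite exprn_gt0.
have := ratioI_lt_of_succ x0 v_ge (addr_sqrtr_sqrD_gt0 _ x2)
  (ratioI_gt_sqrt_half x0 v1).
have -> : v + 1 - 1 / 2 = v + 1 / 2 by field.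
by rewrite divr_addr_sqrtr//; lra.
Qed.

Lemma ratioK_ge_sqrt_weighted v x : 0 < x -> 2 <= v ->
  v + 2 + Num.sqrt ((v - 2) ^+ 2 + (v - 2) / (v - 1) * x ^+ 2) <= ratioK v x.
Proof.
move=> x0; rewrite le_eqVlt => /predU1P[<-|v2].
  rewrite subrr !mul0r expr0n/= addr0 sqrtr0 addr0 (ratioK_rec 2 x0).
  have : 0 < x ^+ 2 / ratioK (2 - 1) x.
    by rewrite divr_gt0 ?exprn_gt0 ?ratioK_gt0.
  by lra.
have v1 : 1 < v - 1 by lra.
have := ratioK_ge_of_pred x0 (ratioK_le_sqrt_weighted x0 v1).
have -> : v - 1 - 1 = v - 2 by ring.
by rewrite divr_addr_sqrtr_weighted; lra.
Qed.

Lemma ratioI_lt_sqrt_weighted v x : 0 < x -> -1 < v ->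
  ratioI v x < v - 2 + Num.sqrt ((v + 2) ^+ 2 + (v + 2) / (v + 1) * x ^+ 2).
Proof.
move=> x0 v1; have v10 : 0 < v + 1 by lra.
have := ratioI_gt_sqrt_weighted x0 v10.
move=> /(ratioI_lt_of_succ x0 (ltW v1) (ltr_pwDl v10 (sqrtr_ge0 _))).
have -> : v + 1 + 1 = v + 2 by ring.
by rewrite divr_addr_sqrtr_weighted; lra.
Qed.

End ratio_recurrence_bounds.

Section besselIK_inverse_bounds.
Context {R : realType}.
Variables (nu x : R).
Hypotheses (x_gt0 : 0 < x) (nu_ge : -1 <= nu).
Implicit Types A B : R.

Lemma besselIK_inv_gt_ratioK A B : A <= ratioK nu x -> ratioI (nu + 1) x < B ->
  A + x ^+ 2 / B < (besselI nu x * besselK nu x)^-1.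
Proof.
move=> leA ltB; rewrite besselIK_inv_ratioK// ler_ltD//.
by rewrite ltr_pdiv2l ?exprn_gt0// ratioI_gt0//; have := nu_ge; lra.
Qed.

Lemma besselIK_inv_lt_ratioK A B : 0 < B ->
  ratioK nu x <= A -> B < ratioI (nu + 1) x ->
  (besselI nu x * besselK nu x)^-1 < A + x ^+ 2 / B.
Proof.
move=> B0 leA ltB; rewrite besselIK_inv_ratioK// ler_ltD//.
by rewrite ltr_pdiv2l ?exprn_gt0.
Qed.

Lemma besselIK_inv_gt_ratioI A B : A < ratioI nu x -> ratioK (nu - 1) x <= B ->
  A + x ^+ 2 / B < (besselI nu x * besselK nu x)^-1.
Proof.
move=> ltA leB; rewrite besselIK_inv_ratioI// ltr_leD//.
by rewrite ler_pdiv2l ?exprn_gt0 ?ratioK_gt0.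
Qed.

Lemma besselIK_inv_lt_ratioI A B : 0 < B ->
  ratioI nu x < A -> B <= ratioK (nu - 1) x ->
  (besselI nu x * besselK nu x)^-1 < A + x ^+ 2 / B.
Proof.
move=> B0 ltA leB; rewrite besselIK_inv_ratioI// ltr_leD//.
by rewrite ler_pdiv2l ?exprn_gt0.
Qed.

End besselIK_inverse_bounds.

(** * Bounds on the product *)

Section denF_bounds.
Context {R : realType}.
Variables nu x : R.
Hypothesis x_gt0 : 0 < x.

Notation IK_inv := ((besselI nu x * besselK nu x)^-1).

Let signE := (@opprK R, @mulrN1 R, @mulNr R, @mulr1 R).

Let x2_gt0 : 0 < x ^+ 2. Proof. by rewrite exprn_gt0. Qed.

Let esqrt_ratioE a b : b != 0 ->
  esqrt_ratio a b x = (Num.sqrt (a ^+ 2 + a / b * x ^+ 2))%:E.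
Proof. by move=> b0; rewrite /esqrt_ratio inver (negPf b0). Qed.

Let esqrt_ratio_y a : 0 < a -> esqrt_ratio a 0 x = +oo%E.
Proof.
move=> a0; rewrite /esqrt_ratio inve0 gt0_muley ?lte_fin//.
by rewrite gt0_mulye ?lte_fin.
Qed.

Lemma addr_sqrtr_sqrD_ge1 a :
  0 <= Num.sqrt (a ^+ 2 + x ^+ 2) + Num.sqrt ((a + 1) ^+ 2 + x ^+ 2) - 1.
Proof.
have := normr_lt_sqrtr_sqrD a x2_gt0.
have := normr_lt_sqrtr_sqrD (a + 1) x2_gt0.
by have := ler_norm (a + 1); have := ler_norm (- a); rewrite normrN; lra.
Qed.

Lemma besselIK_inv_lt_denF_B01 : -1 <= nu -> (IK_inv%:E < denF B01 (-1) nu x)%E.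
Proof.
move=> nu_ge; have nu1 : -1 <= nu + 1 by lra.
rewrite /denF lte_fin !signE.
have ratioI_gt : nu + Num.sqrt (nu ^+ 2 + x ^+ 2) < ratioI (nu + 1) x.
  apply: le_lt_trans (ratioI_gt_sqrt_succ x_gt0 nu1).
  by rewrite addrK lerD2l ler_wsqrtr// lerD2r; nra.
have := besselIK_inv_lt_ratioK x_gt0 nu_ge (addr_sqrtr_sqrD_gt0 nu x2_gt0)
  (ratioK_le_sqrt_succ nu x_gt0) ratioI_gt.
by rewrite divr_addr_sqrtr//; lra.
Qed.

Lemma denF_B11_lt_besselIK_inv : -1 <= nu ->
  (0 <= denF B11 1 nu x < IK_inv%:E)%E.
Proof.
move=> nu_ge; have nu1 : 0 <= nu + 1 by lra.
rewrite /denF lee_fin lte_fin addr_sqrtr_sqrD_ge1/=.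
have := besselIK_inv_gt_ratioK x_gt0 nu_ge (ratioK_ge_sqrt nu x_gt0)
  (ratioI_lt_sqrt x_gt0 nu1).
by rewrite divr_addr_sqrtr//; lra.
Qed.

Lemma besselIK_inv_lt_denF_B11 : 0 <= nu -> (IK_inv%:E < denF B11 (-1) nu x)%E.
Proof.
move=> nu0; have nu_ge : -1 <= nu by lra.
rewrite /denF lte_fin !signE.
have := besselIK_inv_lt_ratioI x_gt0 nu_ge
  (addr_sqrtr_sqrD_gt0 (nu - 1) x2_gt0) (ratioI_lt_sqrt x_gt0 nu0)
  (ratioK_ge_sqrt (nu - 1) x_gt0).
by rewrite divr_addr_sqrtr//; lra.
Qed.

Lemma denF_B01_lt_besselIK_inv : 0 <= nu ->
  (0 <= denF B01 1 nu x < IK_inv%:E)%E.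
Proof.
move=> nu0; have nu_ge : -1 <= nu by lra.
have /andP[_] := denF_B11_lt_besselIK_inv nu_ge.
rewrite /denF lee_fin !lte_fin => /(le_lt_trans _) -> //; last first.
  by rewrite lerD2r lerD2l ler_wsqrtr// lerD2r; nra.
by rewrite andbT; have := addr_sqrtr_sqrD_ge1 (nu - 1); rewrite subrK; lra.
Qed.

Lemma besselIK_inv_lt_denF_B10 : 1 <= nu -> (IK_inv%:E < denF B10 (-1) nu x)%E.
Proof.
rewrite /denF le_eqVlt => /predU1P[<-|nu1].
  by rewrite subrr esqrt_ratio_y// gt0_muley ?ltry// lte_fin.
have nu0 : 0 <= nu by lra.
rewrite esqrt_ratioE ?subr_eq0 ?gt_eqF// lte_fin besselIK_inv_sum//;
  last by lra.
have I_lt := ratioI_lt_sqrt x_gt0 nu0.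
have K_le := ratioK_le_sqrt_weighted x_gt0 nu1.
have : Num.sqrt (nu ^+ 2 + x ^+ 2)
    <= Num.sqrt (nu ^+ 2 + nu / (nu - 1) * x ^+ 2).
  by rewrite ler_wsqrtr// lerD2l ler_peMl ?(ltW x2_gt0)// ler_pdivlMr; lra.
by lra.
Qed.

Lemma denF_B10_lt_besselIK_inv : 0 <= nu ->
  (0 <= denF B10 1 nu x < IK_inv%:E)%E.
Proof.
move=> nu_ge0; have nu_ge : -1 <= nu by lra.
rewrite /denF esqrt_ratioE ?gt_eqF//; last by lra.
rewrite -EFinM lee_fin lte_fin mulr_ge0 ?sqrtr_ge0//=.
move: nu_ge0; rewrite le_eqVlt => /predU1P[nu0|nu0].
  rewrite -{1 2}nu0 !mul0r expr0n/= addr0 sqrtr0 mulr0 invr_gt0.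
  exact: besselIK_gt0.
rewrite besselIK_inv_sum//.
have I_gt := ratioI_gt_sqrt_weighted x_gt0 nu0.
have K_ge := ratioK_ge_sqrt nu x_gt0.
have : Num.sqrt (nu ^+ 2 + nu / (nu + 1) * x ^+ 2)
    <= Num.sqrt (nu ^+ 2 + x ^+ 2).
  by rewrite ler_wsqrtr// lerD2l ler_piMl ?(ltW x2_gt0)// ler_pdivrMr; lra.
by lra.
Qed.

Lemma besselIK_inv_lt_denF_B02 : - (1 / 2) <= nu ->
  (IK_inv%:E < denF B02 (-1) nu x)%E.
Proof.
move=> nu_ge; have nu1 : 1 / 2 <= nu + 1 by lra.
have nu_geN1 : -1 <= nu by lra.
rewrite /denF lte_fin !signE.
have := besselIK_inv_lt_ratioK x_gt0 nu_geN1 (addr_sqrtr_sqrD_gt0 _ x2_gt0)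
  (ratioK_le_sqrt_half x_gt0 nu_ge) (ratioI_gt_sqrt_half x_gt0 nu1).
have -> : nu + 1 - 1 / 2 = nu + 1 / 2 by field.
by rewrite divr_addr_sqrtr//; lra.
Qed.

Lemma denF_B02_lt_besselIK_inv : 1 / 2 <= nu ->
  (0 <= denF B02 1 nu x < IK_inv%:E)%E.
Proof.
move=> nu_ge; have nu1 : - (1 / 2) <= nu - 1 by lra.
have nu_geN1 : -1 <= nu by lra.
rewrite /denF lee_fin lte_fin mulr_ge0 ?sqrtr_ge0//=.
have := besselIK_inv_gt_ratioI x_gt0 nu_geN1 (ratioI_gt_sqrt_half x_gt0 nu_ge)
  (ratioK_le_sqrt_half x_gt0 nu1).
have -> : nu - 1 + 1 / 2 = nu - 1 / 2 by field.
by rewrite divr_addr_sqrtr//; lra.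
Qed.

Lemma besselIK_inv_lt_denF_B20 : 1 <= nu -> (IK_inv%:E < denF B20 (-1) nu x)%E.
Proof.
move=> nu1; have nu_gt : -1 < nu by lra.
rewrite /denF !signE esqrt_ratioE; last by rewrite gt_eqF//; lra.
move: nu1; rewrite le_eqVlt => /predU1P[<-|nu1].
  by rewrite subrr esqrt_ratio_y// ltry.
rewrite esqrt_ratioE ?subr_eq0 ?gt_eqF// lte_fin besselIK_inv_sum//;
  last by lra.
have := ratioI_lt_sqrt_weighted x_gt0 nu_gt.
by have := ratioK_le_sqrt_weighted x_gt0 nu1; lra.
Qed.

Lemma denF_B20_lt_besselIK_inv : 2 <= nu ->
  (0 <= denF B20 1 nu x < IK_inv%:E)%E.
Proof.
move=> nu2; have nu0 : 0 < nu by lra.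
rewrite /denF !signE !esqrt_ratioE; try by rewrite gt_eqF//; lra.
rewrite -!EFinD lee_fin lte_fin !addr_ge0 ?sqrtr_ge0//= besselIK_inv_sum//;
  last by lra.
have := ratioI_gt_sqrt_weighted x_gt0 nu0.
by have := ratioK_ge_sqrt_weighted x_gt0 nu2; lra.
Qed.

Lemma besselIK_inv_lt_denF_B12 : 3 / 2 <= nu ->
  (IK_inv%:E < denF B12 (-1) nu x)%E.
Proof.
move=> nu_ge; have nuI : - (1 / 2) <= nu by lra.
have nuK : 1 / 2 <= nu - 1 by lra.
have nu_geN1 : -1 <= nu by lra.
have := ratioK_ge_sqrt_half x_gt0 nuK.
have -> : nu - 1 + 1 / 2 = nu - 1 / 2 by field.
have -> : nu - 1 - 1 / 2 = nu - 3 / 2 by field.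
rewrite /denF lte_fin !signE.
move=> K_ge; apply: besselIK_inv_lt_ratioI K_ge => //; last first.
  exact: ratioI_lt_sqrt_half.
by rewrite ltr_pwDl ?sqrtr_ge0//; lra.
Qed.

Lemma denF_B12_lt_besselIK_inv : 1 / 2 <= nu ->
  (0 <= denF B12 1 nu x < IK_inv%:E)%E.
Proof.
move=> nu_ge; have nuI : - (1 / 2) <= nu + 1 by lra.
have nu_geN1 : -1 <= nu by lra.
have nu0 : 0 <= nu + 1 / 2 by lra.
rewrite /denF !signE lee_fin lte_fin; apply/andP; split.
  by rewrite addr_ge0 ?divr_ge0 ?(ltW x2_gt0)// addr_ge0 ?sqrtr_ge0.
have := ratioI_lt_sqrt_half x_gt0 nuI.
have -> : nu + 1 - 1 / 2 = nu + 1 / 2 by field.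
have -> : nu + 1 + 1 / 2 = nu + 3 / 2 by field.
move=> I_lt; apply: besselIK_inv_gt_ratioK I_lt => //.
exact: ratioK_ge_sqrt_half.
Qed.

Lemma besselIK_inv_lt_denF_B21 : -1 <= nu -> (IK_inv%:E < denF B21 (-1) nu x)%E.
Proof.
move=> nu_ge; have nu1 : -1 <= nu + 1 by lra.
have := ratioI_gt_sqrt_succ x_gt0 nu1; rewrite addrK.
have -> : nu + 1 + 1 = nu + 2 by ring.
rewrite /denF lte_fin !signE.
move=> I_gt; apply: besselIK_inv_lt_ratioK I_gt => //; last first.
  exact: ratioK_le_sqrt_pred.
apply: lt_le_trans (addr_sqrtr_sqrD_gt0 nu x2_gt0) _.
by rewrite lerD2l ler_wsqrtr// lerD2r; nra.
Qed.

Lemma denF_B21_lt_besselIK_inv : 0 <= nu ->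
  (0 <= denF B21 1 nu x < IK_inv%:E)%E.
Proof.
move=> nu0; have nu_ge : -1 <= nu by lra.
rewrite /denF !signE lee_fin lte_fin; apply/andP; split.
  rewrite addr_ge0//.
    have := normr_lt_sqrtr_sqrD (nu + 1) x2_gt0.
    by have := ler_norm (nu + 1); lra.
  by rewrite divr_ge0 ?(ltW x2_gt0)// addr_ge0 ?sqrtr_ge0.
have := ratioK_le_sqrt_pred (nu - 1) x_gt0; rewrite subrK.
have -> : nu - 1 - 1 = nu - 2 by ring.
move=> K_le; apply: besselIK_inv_gt_ratioI K_le => //.
exact: ratioI_gt_sqrt_succ.
Qed.

Lemma besselIK_inv_lt_denF_B30 : 3 <= nu -> (IK_inv%:E < denF B30 (-1) nu x)%E.
Proof.
move=> nu3; have nuI : -1 < nu by lra.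
have nuK : 2 <= nu - 1 by lra.
have := ratioK_ge_sqrt_weighted x_gt0 nuK.
have -> : nu - 1 - 2 = nu - 3 by ring.
have -> : nu - 1 - 1 = nu - 2 by ring.
set B := Num.sqrt _ => K_ge.
rewrite /denF lte_fin !signE -/B.
have B_gt0 : 0 < nu - 1 + B by rewrite ltr_pwDl ?sqrtr_ge0//; lra.
have {}K_ge : nu - 1 + B <= ratioK (nu - 1) x by lra.
apply: besselIK_inv_lt_ratioI B_gt0 _ K_ge => //; first exact: ltW.
exact: ratioI_lt_sqrt_weighted.
Qed.

Lemma denF_B30_lt_besselIK_inv : 2 <= nu ->
  (0 <= denF B30 1 nu x < IK_inv%:E)%E.
Proof.
move=> nu2; have nuI : -1 < nu + 1 by lra.
have nu_geN1 : -1 <= nu by lra.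
have nu1_ge0 : 0 <= nu + 1 by lra.
have nu2_ge0 : 0 <= nu + 2 by lra.
rewrite /denF !signE lee_fin lte_fin; apply/andP; split.
  by rewrite addr_ge0 ?divr_ge0 ?(ltW x2_gt0)// addr_ge0 ?sqrtr_ge0.
have := ratioI_lt_sqrt_weighted x_gt0 nuI.
have -> : nu + 1 + 2 = nu + 3 by ring.
have -> : nu + 1 + 1 = nu + 2 by ring.
set B := Num.sqrt (_ + _ / _ * _) => I_lt.
have {}I_lt : ratioI (nu + 1) x < nu + 1 + B by lra.
apply: besselIK_inv_gt_ratioK I_lt => //.
exact: ratioK_ge_sqrt_weighted.
Qed.

Lemma besselIK_inv_lt_denF_B03 : 1 / 2 <= nu ->
  (IK_inv%:E < denF B03 (-1) nu x)%E.
Proof.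
move=> nu_ge; have nuI : 1 / 2 < nu + 1 by lra.
have nu_geN1 : -1 <= nu by lra.
have := ratioI_gt_sqrt_quarter x_gt0 nuI.
have -> : nu + 1 - 1 / 2 = nu + 1 / 2 by field.
rewrite /denF lte_fin !signE.
move=> I_gt; apply: besselIK_inv_lt_ratioK I_gt => //; last first.
  exact: ratioK_le_sqrt_quarter.
by rewrite ltr_pwDl ?sqrtr_ge0//; lra.
Qed.

Lemma denF_B03_lt_besselIK_inv : 3 / 2 <= nu ->
  (0 <= denF B03 1 nu x < IK_inv%:E)%E.
Proof.
move=> nu_ge; have nuI : 1 / 2 < nu by lra.
have nuK : 1 / 2 <= nu - 1 by lra.
have nu_geN1 : -1 <= nu by lra.
have nu0 : 0 <= nu - 1 / 2 by lra.
rewrite /denF lee_fin lte_fin; apply/andP; split.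
  by rewrite addr_ge0 ?divr_ge0 ?(ltW x2_gt0)// addr_ge0 ?sqrtr_ge0.
have := ratioK_le_sqrt_quarter x_gt0 nuK.
have -> : nu - 1 + 1 / 2 = nu - 1 / 2 by field.
move=> K_le; apply: besselIK_inv_gt_ratioI K_le => //.
exact: ratioI_gt_sqrt_quarter.
Qed.

Lemma besselIK_inv_lt_denF pq : nuL pq <= nu ->
  (IK_inv%:E < denF pq (-1) nu x)%E.
Proof.
case: pq.
- exact: besselIK_inv_lt_denF_B01.
- exact: besselIK_inv_lt_denF_B10.
- exact: besselIK_inv_lt_denF_B02.
- exact: besselIK_inv_lt_denF_B11.
- exact: besselIK_inv_lt_denF_B20.
- exact: besselIK_inv_lt_denF_B12.
- exact: besselIK_inv_lt_denF_B21.
- exact: besselIK_inv_lt_denF_B30.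
- exact: besselIK_inv_lt_denF_B03.
Qed.

Lemma denF_lt_besselIK_inv pq : nuU pq <= nu ->
  (0 <= denF pq 1 nu x < IK_inv%:E)%E.
Proof.
case: pq.
- exact: denF_B01_lt_besselIK_inv.
- exact: denF_B10_lt_besselIK_inv.
- exact: denF_B02_lt_besselIK_inv.
- exact: denF_B11_lt_besselIK_inv.
- exact: denF_B20_lt_besselIK_inv.
- exact: denF_B12_lt_besselIK_inv.
- exact: denF_B21_lt_besselIK_inv.
- exact: denF_B30_lt_besselIK_inv.
- exact: denF_B03_lt_besselIK_inv.
Qed.

End denF_bounds.

Lemma nuL_ge (R : realType) pq : -1 <= nuL pq :> R.
Proof. by case: pq; rewrite /nuL; lra. Qed.

Lemma nuU_ge (R : realType) pq : -1 <= nuU pq :> R.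
Proof. by case: pq; rewrite /nuU; lra. Qed.

Theorem theorem1 (R : realType) (pq : bound_label) (nu x : R) :
  0 < x ->
  (nuL pq <= nu ->
     (boundF pq (- 1) nu x < (besselI nu x * besselK nu x)%:E)%E) /\
  (nuU pq <= nu ->
     ((besselI nu x * besselK nu x)%:E < boundF pq 1 nu x)%E).
Proof.
move=> x_gt0; rewrite /boundF; set IK := besselI nu x * besselK nu x.
have IK_invE : -1 <= nu -> 0 < IK /\ (IK%:E^-1 = IK^-1%:E)%E.
  move=> nu_ge; have IK_gt0 := besselIK_gt0 x_gt0 nu_ge.
  by rewrite inver gt_eqF.
split=> [nuL_le|nuU_le].
- have [IK_gt0 IK_inv] := IK_invE (le_trans (nuL_ge R pq) nuL_le).
  have IK_inv_lt := besselIK_inv_lt_denF x_gt0 nuL_le.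
  have denF_ge0 : (0 <= denF pq (-1) nu x)%E.
    by apply: le_trans (ltW IK_inv_lt); rewrite lee_fin invr_ge0 ltW.
  by rewrite inve_plt ?inE ?lee_fin ?(ltW IK_gt0)// IK_inv.
- have [IK_gt0 IK_inv] := IK_invE (le_trans (nuU_ge R pq) nuU_le).
  have /andP[denF_ge0 denF_lt] := denF_lt_besselIK_inv x_gt0 nuU_le.
  by rewrite inve_pgt ?inE ?lee_fin ?(ltW IK_gt0)// IK_inv.
Qed.
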